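(* Let $\mathcal{C}$ be a clutter with the König property, without isolated vertices, and without cycles of length $3$ or $4$. Then the following conditions are equivalent: (a) $\mathcal{C}$ is unmixed. (b) There is a perfect matching $e_1,\ldots,e_g$ of $\mathcal{C}$, with $g={\rm ht}\, I(\mathcal{C})$, such that $e_i$ has a free vertex for all $i$, and for any two edges $f_1,f_2$ of $\mathcal{C}$ and for any edge $e_i$ of the perfect matching, one has $f_1\cap e_i\subset f_2\cap e_i$ or $f_2\cap e_i\subset f_1\cap e_i$. (c) $R/I(\mathcal{C})$ is Cohen-Macaulay. (d) $\Delta_{\mathcal{C}}$ is a pure shellable simplicial complex.
   Context: A clutter $\mathcal{C}$ with finite vertex set $X=\{x_1,\ldots,x_n\}$ is a family $E(\mathcal{C})$ of subsets of $X$, called edges, none of which is included in another. A vertex is isolated if it occurs in no edge, and free if it occurs in exactly one edge. $R=K[x_1,\ldots,x_n]$ is a polynomial ring over a field $K$, and the edge ideal $I(\mathcal{C})\subset R$ is generated by the monomials $\prod_{x_i\in e}x_i$, $e\in E(\mathcal{C})$. A vertex cover of $\mathcal{C}$ is a subset of $X$ meeting every edge; it is minimal if no proper subset is a vertex cover. The height ${\rm ht}\, I(\mathcal{C})$ equals the minimum size of a vertex cover. $\mathcal{C}$ is unmixed if all its minimal vertex covers have the same size. $\mathcal{C}$ has the König property if the maximum number of pairwise disjoint edges of $\mathcal{C}$ equals ${\rm ht}\, I(\mathcal{C})$. A perfect matching of $\mathcal{C}$ is a set of pairwise disjoint edges whose union is $X$. The incidence matrix of $\mathcal{C}$, with edges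 $g_1,\ldots,g_q$, is $A=(a_{ij})$ with $a_{ij}=1$ if $x_i\in g_j$ and $a_{ij}=0$ otherwise. $\mathcal{C}$ has a cycle of length $r$ (where $r\geq 3$) if there is a square submatrix of $A$ of order $r$ with exactly two $1$'s in each row and column. $\Delta_{\mathcal{C}}$ is the simplicial complex on $X$ whose faces are the subsets of $X$ containing no edge of $\mathcal{C}$. A simplicial complex $\Delta$ is shellable if its facets can be ordered $F_1,\ldots,F_s$ such that for all $1\leq i<j\leq s$ there exist $v\in F_j\setminus F_i$ and $\ell\in\{1,\ldots,j-1\}$ with $F_j\setminus F_\ell=\{v\}$. It is pure if all its facets have the same dimension, and pure shellable if it is both pure and shellable. The symbol $\subset$ allows equality. *)

(* Defs.v *)
From HB Require Import structures.
From mathcomp Require Import all_boot all_order all_algebra.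
From mathcomp Require Import mpoly.

Set Implicit Arguments.
Unset Strict Implicit.
Unset Printing Implicit Defensive.

Import GRing.Theory.
Local Open Scope ring_scope.

Section Clutters.

Variable n : nat.

Implicit Types (E M : {set {set 'I_n}}) (S e f : {set 'I_n}) (v : 'I_n).

Definition is_clutter E : Prop := {in E &, forall e f, e \subset f -> e = f}.

Definition isolated E v : bool := [forall e in E, v \notin e].

Definition free_vertex E v : bool := #|[set e in E | v \in e]| == 1%N.

Definition vertex_cover E S : bool := [forall e in E, S :&: e != set0].

Definition min_vertex_cover E S : bool := minset (vertex_cover E) S.

Definition unmixed E : Prop :=
  forall S1 S2, min_vertex_cover E S1 -> min_vertex_cover E S2 ->
    #|S1| = #|S2|.

(* The height of the edge ideal, as the minimum size of a vertex cover.  There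
   is no cover exactly when set0 is an edge; the value is then n. *)
Definition ht_edge_ideal E : nat :=
  #|[arg min_(S < [set: 'I_n] | vertex_cover E S) #|S|]|.

Definition matching E M : bool := (M \subset E) && trivIset M.

Definition matching_number E : nat :=
  \max_(M : {set {set 'I_n}} | matching E M) #|M|.

Definition konig E : Prop := matching_number E = ht_edge_ideal E.

Definition perfect_matching E M : bool :=
  matching E M && (cover M == [set: 'I_n]).

Definition incidence_mx E : 'M[nat]_(n, #|E|) :=
  \matrix_(i, j) nat_of_bool (i \in (enum_val j : {set 'I_n})).

(* Injective, not necessarily increasing, choices of rows and columns suffice:
   the condition is invariant under permutations of rows and columns. *)
Definition has_cycle E (r : nat) : Prop :=
  [/\ (3 <= r)%N &
      exists (rows : 'I_r -> 'I_n) (cols : 'I_r -> 'I_#|E|),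
        let B := mxsub rows cols (incidence_mx E) in
        [/\ injective rows, injective cols,
            forall i, #|[set j | B i j == 1%N]| = 2%N
          & forall j, #|[set i | B i j == 1%N]| = 2%N]].

Definition indep_complex E : {set {set 'I_n}} :=
  [set S : {set 'I_n} | [forall e in E, ~~ (e \subset S)]].

Definition facets (D : {set {set 'I_n}}) : {set {set 'I_n}} :=
  [set S : {set 'I_n} | maxset (fun F => F \in D) S].

(* dim S = #|S| - 1, so that equal dimensions are equal cardinals. *)
Definition pure_complex (D : {set {set 'I_n}}) : Prop :=
  {in facets D &, forall S1 S2, #|S1| = #|S2|}.

Definition shellable (D : {set {set 'I_n}}) : Prop :=
  exists F : seq {set 'I_n},
    [/\ uniq F, F =i facets D &
        forall i j, (i < j < size F)%N ->
          exists v l,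
            [/\ v \in nth set0 F j :\: nth set0 F i, (l < j)%N &
                nth set0 F j :\: nth set0 F l = [set v]]].

Definition edge_ideal_gens (K : fieldType) E : seq {mpoly K[n]} :=
  [seq \prod_(i in (e : {set 'I_n})) 'X_i | e <- enum E].

End Clutters.

Section CohenMacaulay.

Variable R : comNzRingType.

Implicit Types (gs hs : seq R) (m J : {pred R}) (P : nat -> {pred R}).

Definition in_ideal_of gs (f : R) : Prop :=
  exists c : nat -> R, f = \sum_(i < size gs) c i * gs`_i.

(* idealr_closed excludes the unit ideal. *)
Definition is_prime_ideal J : Prop := idealr_closed J /\ prime_idealr_closed J.

Definition is_maximal_ideal m : Prop :=
  idealr_closed m /\
  forall J, idealr_closed J -> {subset m <= J} -> {subset J <= m}.

(* f / 1 lies in the extension of the ideal (gs) to the localization R_m. *)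
Definition in_localized_ideal m gs (f : R) : Prop :=
  exists2 t : R, t \notin m & in_ideal_of gs (t * f).

(* hs is a regular sequence on (R/(gs))_m inside the maximal ideal of R_m.
   Multiplying by units of R_m, one may take the terms of the sequence, and the
   elements f they are tested against, to be fractions with denominator 1.
   When m contains gs, the quotient of (R/(gs))_m by hs is nonzero, since hs
   lies in m. *)
Definition regular_seq_at m gs hs : Prop :=
  {subset hs <= m} /\
  forall i, (i < size hs)%N -> forall f,
    in_localized_ideal m (gs ++ take i hs) (f * hs`_i) ->
    in_localized_ideal m (gs ++ take i hs) f.

Definition depth_at m gs (d : nat) : Prop :=
  (exists2 hs, regular_seq_at m gs hs & size hs = d) /\
  (forall hs, regular_seq_at m gs hs -> (size hs <= d)%N).

(* Strict chains P 0 < ... < P d of primes of R with (gs) <= P 0 and P d <= m: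
   they correspond to the chains of primes of (R/(gs))_m. *)
Definition prime_chain_at m gs (d : nat) P : Prop :=
  [/\ forall i, (i <= d)%N -> is_prime_ideal (P i),
      forall i, (i < d)%N ->
        {subset P i <= P i.+1} /\ ~ {subset P i.+1 <= P i},
      {subset gs <= P 0%N} & {subset P d <= m}].

Definition krull_dim_at m gs (d : nat) : Prop :=
  (exists P, prime_chain_at m gs d P) /\
  (forall e P, prime_chain_at m gs e P -> (e <= d)%N).

(* The ring R/(gs) is Cohen-Macaulay: depth and Krull dimension agree for its
   localization at every maximal ideal. *)
Definition cohen_macaulay_quotient gs : Prop :=
  forall m, is_maximal_ideal m -> {subset gs <= m} ->
    exists2 d, depth_at m gs d & krull_dim_at m gs d.

End CohenMacaulay.

(* Main.v *)
Require Import Defs.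
From HB Require Import structures.
From mathcomp Require Import all_boot all_order all_algebra.
From mathcomp Require Import mpoly boolp ring zify.

Set Implicit Arguments.
Unset Strict Implicit.
Unset Printing Implicit Defensive.

Import Order.TTheory GRing.Theory.
Local Open Scope ring_scope.

(** Let [g] be the height, and for a set [S] of vertices let [P_S] be the prime
ideal generated by the variables of [S].  The conditions are proved in the
cycle (a), (b), (c), (d), where (c) implies (d) by way of (a) and (b).

(a) implies (b).  A set of vertices that contains no edge is avoided by some
minimal vertex cover ([min_vertex_cover_avoiding]).  Let [M] be a matching with
[g] edges.  When all minimal covers have [g] vertices, each of them has exactly
one vertex in each edge of [M] and none elsewhere; since each vertex lies in a
minimal cover, [M] is perfect.  Suppose that two edges [f1], [f2] cross inside
[e \in M], with [x] in the first only and [y] in the second only.  Then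
[(f1 :\ x) :|: (f2 :\ y)] contains an edge, because a minimal cover avoiding it
would contain both [x] and [y]; that edge closes a cycle of length 3 or 4 with
[e], [f1] and [f2] ([nested_edges]).  So the traces of the edges on a block [e]
of [M] form a chain, and a vertex of [e] in the fewest edges lies in [e] alone.

(b) implies (d).  By nestedness, a vertex of a minimal cover may be replaced by
any vertex of the same block that lies in at least as many edges.  List the
minimal covers by decreasing weight, where the weight of a vertex is its number
of edges with ties broken by its index.  If [S] comes before [T], then some
block meets [S] in a vertex heavier than its vertex in [T]; exchanging these
vertices in [T] gives an earlier cover, which differs from [T] in that block
only.  This is a shelling ([nested_matching_shellable]).

(b) implies (c).  The edge ideal [I] is the intersection of the [P_S] over the
minimal covers [S], and a shelling filters [R/I] with successive quotients
isomorphic to the rings [R/P_S].  A sequence that is regular on all of them is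
thus regular on [R/I] ([shelling_weakly_regular]).  Fix a maximal ideal [m] over
[I] and a base vertex [c e] in each block [e].  For each other vertex [v] of
[e], Hilbert's Nullstellensatz ([maximal_ideal_algebraic]) gives a nonzero
polynomial [q] in one variable with [q (x_v - x_(c e)) \in m].  These [n - g]
elements form a regular sequence on [R/P_S] for each transversal [S], since a
translation of some of the coordinates moves one of them and fixes the others
and [P_S] ([transversal_weakly_regular]).  So the depth at [m] is at least
[n - g].  A regular sequence gives a chain of primes of the same length
([regular_seq_prime_chain]), and a chain of primes over [P_S] has length at
most [n - #|S|] ([prime_chain_length]), so that the depth and the dimension at
[m] are both equal to [n - g].

(c) implies (a).  For a minimal cover [S], the ideal [P_S] kills modulo [I] the
product of the variables outside [S], which is not in [I] even locally at the
origin.  Chains of primes obtained from regular sequences can be made to start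
at such an annihilator, so the depth at the origin is at most [n - #|S|], while
adding the remaining variables to [P_S] one by one shows that the dimension is
at least [n - #|S|].  Hence [#|S|] does not depend on [S]. *)

(** * Ideals as predicates *)

Section Ideals.

Variable R : comNzRingType.
Implicit Types (J A B : R -> Prop) (m : {pred R}) (gs hs : seq R).

(** Unlike in [idealr_closed], the unit ideal is allowed. *)
Definition ideal J := J 0 /\ forall a x y, J x -> J y -> J (a * x + y).

Definition adjoin J h f := exists a, J (f - a * h).

(** The contraction to [R] of the extension of [J] to the localization of [R] at
[m]. *)
Definition localize m J f := exists2 t, t \notin m & J (t * f).

Lemma ideal0 J : ideal J -> J 0. Proof. by case. Qed.

Lemma idealD J x y : ideal J -> J x -> J y -> J (x + y).
Proof. by move=> [_ idJ] Jx Jy; rewrite -[x]mul1r; apply: idJ. Qed.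

Lemma idealMl J a x : ideal J -> J x -> J (a * x).
Proof. by move=> [J0 idJ] Jx; rewrite -[a * x]addr0; apply: idJ. Qed.

Lemma idealN J x : ideal J -> J x -> J (- x).
Proof. by move=> idJ Jx; rewrite -mulN1r; apply: idealMl. Qed.

Lemma idealB J x y : ideal J -> J x -> J y -> J (x - y).
Proof. by move=> idJ Jx Jy; apply: idealD => //; apply: idealN. Qed.

Lemma ideal_sum J (I : Type) (r : seq I) (P : pred I) (F : I -> R) :
  ideal J -> (forall i, P i -> J (F i)) -> J (\sum_(i <- r | P i) F i).
Proof.
move=> idJ JF; apply: big_ind => //; first exact: ideal0.
by move=> x y; apply: idealD.
Qed.

Lemma ideal_idealr m : idealr_closed m -> ideal (fun x => x \in m).
Proof. by case=> m0 _ mD; split=> // a x y mx my; apply: mD. Qed.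

Lemma idealr_ideal J : ideal J -> ~ J 1 -> idealr_closed (fun x => `[< J x >]).
Proof.
move=> [J0 idJ] J1; split; first exact/asboolP.
  exact/asboolPn.
by move=> a x y /asboolP Jx /asboolP Jy; apply/asboolP/idJ.
Qed.

Lemma ideal_adjoin J h : ideal J -> ideal (adjoin J h).
Proof.
move=> idJ; split; first by exists 0; rewrite mul0r subr0; apply: ideal0.
move=> a x y [b Jx] [c Jy]; exists (a * b + c).
have -> : a * x + y - (a * b + c) * h = a * (x - b * h) + (y - c * h) by ring.
by apply: idealD => //; apply: idealMl.
Qed.

Lemma adjoin_sub J h x : ideal J -> J x -> adjoin J h x.
Proof. by move=> idJ Jx; exists 0; rewrite mul0r subr0. Qed.

Lemma adjoin_gen J h : ideal J -> adjoin J h h.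
Proof. by move=> idJ; exists 1; rewrite mul1r subrr; apply: ideal0. Qed.

Lemma in_ideal_of_ideal gs : ideal (in_ideal_of gs).
Proof.
split; first by exists (fun=> 0); rewrite big1 // => i _; rewrite mul0r.
move=> a x y [c ->] [d ->]; exists (fun i => a * c i + d i).
by rewrite mulr_sumr -big_split; apply: eq_bigr => i _; rewrite mulrDl mulrA.
Qed.

Lemma in_ideal_of_mem gs g : g \in gs -> in_ideal_of gs g.
Proof.
move=> gsg; have lt_g : (index g gs < size gs)%N by rewrite index_mem.
exists (fun i => (i == index g gs)%:R).
rewrite (bigD1 (Ordinal lt_g)) //= eqxx mul1r nth_index // big1 ?addr0 // => i.
by rewrite -val_eqE /= => /negPf ->; rewrite mul0r.
Qed.

Lemma in_ideal_of_min J gs f :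
  ideal J -> {in gs, forall g, J g} -> in_ideal_of gs f -> J f.
Proof.
move=> idJ Jgs [c ->]; apply: ideal_sum => // i _.
by apply: idealMl => //; apply/Jgs/mem_nth.
Qed.

Lemma in_ideal_of_rcons gs h f :
  in_ideal_of (rcons gs h) f <-> adjoin (in_ideal_of gs) h f.
Proof.
have idg := in_ideal_of_ideal; split.
  apply: in_ideal_of_min; first exact: ideal_adjoin.
  move=> g; rewrite mem_rcons inE => /predU1P[-> | gsg];
    first exact: adjoin_gen.
  exact/adjoin_sub/in_ideal_of_mem.
case=> a Ja; rewrite -[f](subrK (a * h)); apply: idealD => //.
  apply: in_ideal_of_min Ja => // g gsg.
  by apply: in_ideal_of_mem; rewrite mem_rcons inE gsg orbT.
by apply: idealMl => //; apply: in_ideal_of_mem; rewrite mem_rcons inE eqxx.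
Qed.

Lemma is_maximal_prime m : is_maximal_ideal m -> is_prime_ideal m.
Proof.
move=> [idm maxm]; split=> // a b; have [m0 m1 _] := idm.
have idm' := ideal_idealr idm.
apply: contraLR; rewrite negb_or => /andP[ma mb].
have unit_mod x : x \notin m -> exists c, 1 - c * x \in m.
  move=> mx; apply: contrapT => no_c.
  have idJ := ideal_adjoin x idm'.
  have sub := maxm _ (idealr_ideal idJ no_c).
  case/negP: mx; apply: sub; last exact/asboolP/adjoin_gen.
  by move=> y my; apply/asboolP/adjoin_sub.
have [c mc] := unit_mod a ma; have [d md] := unit_mod b mb.
apply: contra m1 => mab.
have -> : 1 = (1 - c * a) + c * (a * (1 - d * b)) + (c * d) * (a * b) by ring.
apply: (idealD idm'); last exact: (idealMl _ idm').
apply: (idealD idm') => //; apply: (idealMl c idm'); exact: (idealMl a idm').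
Qed.

End Ideals.

(** * The Hilbert basis theorem *)

(** The maximal condition, which yields maximal annihilators at once. *)
Definition noetherian (R : comNzRingType) : Prop :=
  forall F : (R -> Prop) -> Prop,
    (exists J, F J) -> (forall J, F J -> ideal J) ->
  exists2 J, F J & forall J', F J' -> (forall x, J x -> J' x) ->
    forall x, J' x -> J x.

(** Each tail of the sequence attains its minimum; the subsequence jumps from
the position of such a minimum to the minimum of the tail after it. *)
Lemma nat_seq_monotone_subseq (a : nat -> nat) :
  exists g : nat -> nat, {homo g : i j / (i < j)%N} /\
    {homo a \o g : i j / (i <= j)%N}.
Proof.
have min_tail N :
    exists i, (N <= i)%N /\ forall j, (N <= j)%N -> (a i <= a j)%N.
  suff tail k i : (N <= i)%N -> (a i < k)%N ->
      exists i, (N <= i)%N /\ forall j, (N <= j)%N -> (a i <= a j)%N.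
    exact: tail (leqnn N) (ltnSn (a N)).
  elim: k i => // k IHk i leNi lt_aik.
  have [min_i | /existsNP[j /not_implyP[leNj /negP]]] :=
    pselect (forall j, (N <= j)%N -> (a i <= a j)%N); first by exists i; split.
  by rewrite -ltnNge => lt_ji; apply: IHk leNj (leq_trans lt_ji lt_aik).
have [next nextP] := choice min_tail.
pose g := fix g k := if k is k'.+1 then next (g k').+1 else next 0%N.
have g_lt k : (g k < g k.+1)%N by case: (nextP (g k).+1).
have g_min k j : (g k <= j)%N -> (a (g k) <= a j)%N.
  case: k => [|k] /= le_j; first by case: (nextP 0%N) => _; apply.
  have [le_k min_k] := nextP (g k).+1; apply: min_k; exact: leq_trans le_j.
have g_homo : {homo g : i j / (i < j)%N}.
  by apply: homo_ltn g_lt => x y z; apply: ltn_trans.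
exists g; split=> // i j; rewrite leq_eqVlt => /predU1P[-> // | lt_ij].
exact/g_min/ltnW/g_homo.
Qed.

(** Passing to a subsequence that is monotone in one more coordinate at a time
ends with a subsequence that is monotone in all of them. *)
Lemma dickson n (s : nat -> 'X_{1..n}) :
  exists i j, (i < j)%N /\ (s i <= s j)%MM.
Proof.
suff [g [g_homo g_le]] : exists g : nat -> nat, {homo g : i j / (i < j)%N} /\
    forall v, v \in enum 'I_n -> {homo (fun k => s (g k) v) : i j / (i <= j)%N}.
  exists (g 0%N), (g 1%N); split; first exact: g_homo.
  by apply/mnm_lepP => v; apply: g_le; rewrite ?mem_enum.
elim: (enum 'I_n) => [|v vs [g [g_homo g_le]]]; first by exists id; split.
have [h [h_homo h_le]] := nat_seq_monotone_subseq (fun k => s (g k) v).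
exists (g \o h); split=> [i j /h_homo/g_homo // | w].
rewrite inE => /predU1P[-> // | vs_w] i j le_ij; apply: g_le => //.
by move: le_ij; rewrite leq_eqVlt => /predU1P[-> // | /h_homo/ltnW].
Qed.

Section HilbertBasis.

Variables (K : fieldType) (n : nat).
Local Notation R := {mpoly K[n]}.

Lemma ideal_gap_minimal (J J' : R -> Prop) f : J' f -> ~ J f ->
  exists g, [/\ J' g, ~ J g &
    forall h, J' h -> (mlead h < mlead g)%O -> J h].
Proof.
have [k] : exists k, k = mlead f by exists (mlead f).
elim/(well_founded_ind (@ltom_wf n)): k f => k IH f kf J'f Jf.
have [min_f | /existsNP[h /not_implyP[J'h /not_implyP[lt_hf Jh]]]] := pselect
  (forall h, J' h -> (mlead h < mlead f)%O -> J h); first by exists f.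
by apply: (IH (mlead h)) J'h Jh; rewrite ?kf.
Qed.

Lemma reduce_mlead (f g : R) : f != 0 -> g != 0 -> (mlead f <= mlead g)%MM ->
  exists a, g - a * f = 0 \/ (mlead (g - a * f) < mlead g)%O.
Proof.
move=> f0 g0 le_fg.
have lf0 : mleadc f != 0 by rewrite mleadc_eq0.
have lg0 : mleadc g != 0 by rewrite mleadc_eq0.
set c := mleadc g / mleadc f; have c0 : c != 0.
  by rewrite mulf_neq0 ?invr_eq0.
pose a : R := c *: 'X_[mlead g - mlead f].
have la : mlead a = (mlead g - mlead f)%MM.
  by rewrite mleadZ_proper ?mleadXm // mcoeffX eqxx mulr1.
have a0 : a != 0.
  by rewrite -mleadc_eq0 la mcoeffZ mcoeffX eqxx mulr1.
have laf : mlead (a * f) = mlead g by rewrite mleadM // la submK.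
exists a; have [->|h0] := eqVneq (g - a * f) 0; [by left | right].
rewrite lt_neqAle; apply/andP; split; last first.
  by apply: le_trans (mleadB_le _ _) _; rewrite laf joinxx.
apply: contra h0 => /eqP lh; rewrite -mleadc_eq0 lh mcoeffB.
rewrite -{2}laf mleadM // mleadcM la mcoeffZ mcoeffX eqxx mulr1.
by rewrite divfK // subrr.
Qed.

(** Without a maximal element there is a strictly increasing sequence of ideals
[J_k], and one can pick [f_k] in [J_(k+1)] and not in [J_k] with the smallest
possible leading monomial.  By Dickson's lemma the leading monomial of some
[f_i] divides that of a later [f_j].  Subtracting a multiple of [f_i], which
lies in [J_j], lowers the leading monomial of [f_j], so the difference is in
[J_j] by the choice of [f_j]; but then so is [f_j]. *)
Lemma mpoly_noetherian : noetherian R.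
Proof.
move=> F [J0 FJ0] Fid; apply: contrapT => no_max.
have bigger (J : {J | F J}) : exists J'g : {J | F J} * R,
    [/\ forall x, sval J x -> sval J'g.1 x, sval J'g.1 J'g.2, ~ sval J J'g.2 &
     forall h, sval J'g.1 h -> (mlead h < mlead J'g.2)%O -> sval J h].
  apply: contrapT => no_bigger; apply: no_max; exists (sval J);
    first exact: svalP.
  move=> J' FJ' sJJ' x J'x; apply: contrapT => Jx; apply: no_bigger.
  have [g [J'g Jg min_g]] := ideal_gap_minimal J'x Jx.
  by exists (exist _ J' FJ', g); split.
have [next nextP] := choice bigger.
pose s := fix s k := if k is k'.+1 then (next (s k')).1
                     else exist (fun J => F J) J0 FJ0.
pose f k := (next (s k)).2.
have s_le i j : (i <= j)%N -> forall x, sval (s i) x -> sval (s j) x.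
  move=> le_ij x; elim: j le_ij => [|j IHj]; first by case: i.
  rewrite leq_eqVlt => /predU1P[-> // | /IHj sj /sj sjx].
  by have [sub _ _ _] := nextP (s j); apply: sub.
have ids k : ideal (sval (s k)) by apply: Fid; apply: svalP.
have f0 k : f k != 0.
  have [_ _ nfk _] := nextP (s k); apply/eqP => fk0; apply: nfk.
  by rewrite -/(f k) fk0; apply: ideal0.
have [i [j [lt_ij le_m]]] := dickson (fun k => mlead (f k)).
have [a red] := reduce_mlead (f0 i) (f0 j) le_m.
have [_ sjf nfj min_j] := nextP (s j); have [_ sif _ _] := nextP (s i).
have idj := ids j; have idj1 := ids j.+1.
have jfi : sval (s j) (f i) by apply: (s_le i.+1).
have jafi : sval (s j) (a * f i) by apply: idealMl.
apply: nfj; rewrite -/(f j) -[f j](subrK (a * f i)); apply: idealD => //.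
case: red => [-> | lt_red]; first exact: ideal0.
apply: min_j => //; apply: (idealB idj1) => //.
exact: (s_le j).
Qed.

End HilbertBasis.

(** * Regular sequences and chains of primes *)

Section AssociatedPrimes.

Variables (R : comNzRingType) (m : {pred R}).
Hypotheses (noethR : noetherian R) (prm : is_prime_ideal m).
Implicit Types (J P : R -> Prop) (Q : {pred R}) (gs hs : seq R).

Lemma prime_notinM a b : a \notin m -> b \notin m -> a * b \notin m.
Proof.
move=> ma mb; apply/negP => /(proj2 prm)/orP[]; exact/negP.
Qed.

Lemma prime_notin1 : 1 \notin m.
Proof. by case: prm => [[]]. Qed.

Lemma localize_sub J x : J x -> localize m J x.
Proof. by move=> Jx; exists 1; rewrite ?prime_notin1 ?mul1r. Qed.

Lemma ideal_localize J : ideal J -> ideal (localize m J).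
Proof.
move=> idJ; split; first by apply: localize_sub; apply: ideal0.
move=> a x y [s ms Jx] [t mt Jy]; exists (s * t); first exact: prime_notinM.
have -> : s * t * (a * x + y) = (t * a) * (s * x) + s * (t * y) by ring.
by apply: idealD => //; apply: idealMl.
Qed.

Lemma localize_unit J t x :
  t \notin m -> localize m J (t * x) -> localize m J x.
Proof.
move=> mt [s ms Jx]; exists (s * t); first exact: prime_notinM.
by rewrite -mulrA.
Qed.

(** An annihilator that is maximal among those of the elements outside
[localize m J] is prime: if it contains [a * b] but not [b], then [a] kills
[b * v], whose annihilator is no larger than that of [v]. *)
Lemma exists_associated_prime J P u :
    ideal J -> ~ localize m J u -> (forall p, P p -> localize m J (p * u)) ->
  exists Q v, [/\ is_prime_ideal Q, {subset Q <= m}, forall p, P p -> p \in Q,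
    ~ localize m J v & forall q, q \in Q -> localize m J (q * v)].
Proof.
move=> idJ Ju Pu; have idl := ideal_localize idJ.
pose ann v : R -> Prop := fun q => localize m J (q * v).
have ideal_ann v : ideal (ann v).
  rewrite /ann; split; first by rewrite mul0r; apply: ideal0.
  by move=> a x y Jx Jy; rewrite mulrDl -mulrA; apply: idealD => //;
    apply: idealMl.
have [||A] := noethR (F := fun A => exists v,
  [/\ ~ localize m J v, forall p, P p -> ann v p & A = ann v]).
- by exists (ann u), u.
- by move=> A [v [_ _ ->]].
case=> v [Jv Pv ->] maxA; exists (fun x => `[< ann v x >]), v; split.
- split; first by apply: idealr_ideal => //; rewrite /ann mul1r.
  move=> a b /asboolP ann_ab; have [ann_b | nann_b] := pselect (ann v b).
    by apply/orP; right; apply/asboolP.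
  apply/orP; left; apply/asboolP; apply: (maxA (ann (b * v))).
  + exists (b * v); split=> // p /Pv ann_p.
    by rewrite /ann mulrCA; apply: idealMl.
  + by move=> x ann_x; rewrite /ann mulrCA; apply: idealMl.
  + by rewrite /ann mulrA.
- move=> q /asboolP ann_q; apply: contraPT ann_q => mq /(localize_unit mq).
  exact: Jv.
- by move=> p Pp; apply/asboolP/Pv.
- exact: Jv.
- by move=> q /asboolP.
Qed.

(** This takes the place of Krull's intersection theorem.  In the localization
at [m], choose [v] with [J + (v)] maximal among the elements that are outside
[J] and killed by [P] modulo [J].  If [v] were in [J + (h)], say [v = a * h]
modulo [J], then [P] would kill [a], as [h] is regular, so that [J + (v)] and
[J + (a)] would be equal by maximality.  Then [a = b * v = b * h * a] modulo [J]
for some [b], and [a] would be in [J] since [1 - b * h] is a unit. *)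
Lemma annihilated_notin_adjoin J P h u :
    ideal J -> h \in m ->
    (forall f, localize m J (f * h) -> localize m J f) ->
    ~ localize m J u -> (forall p, P p -> localize m J (p * u)) ->
  exists v, ~ localize m (adjoin J h) v /\
    forall p, P p -> localize m J (p * v).
Proof.
move=> idJ mh regh Ju Pu; have idl := ideal_localize idJ.
have idm := ideal_idealr (proj1 prm).
(* The extension of [J + (v)] to the localization at [m]. *)
pose gen v : R -> Prop := fun f => exists a,
  exists2 t, t \notin m & localize m J (t * f - a * v).
have ideal_gen v : ideal (gen v).
  split; first by exists 0, 1; rewrite ?prime_notin1 // mulr0 mul0r subr0;
    apply: ideal0.
  move=> c x y [a [s ms Jx]] [b [t mt Jy]].
  exists (c * t * a + s * b), (s * t); first exact: prime_notinM.
  have -> : s * t * (c * x + y) - (c * t * a + s * b) * v =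
    (c * t) * (s * x - a * v) + s * (t * y - b * v) by ring.
  by apply: idealD => //; apply: idealMl.
have [||A] := noethR (F := fun A => exists v,
  [/\ ~ localize m J v, forall p, P p -> localize m J (p * v) & A = gen v]).
- by exists (gen u), u.
- by move=> A [v [_ _ ->]].
case=> v [Jv Pv ->] maxA; exists v; split=> //; case=> t mt [a Ja].
have Jta : localize m J (t * v - a * h) by apply: localize_sub.
have nJa : ~ localize m J a.
  move=> Ja'; apply: Jv; apply: (localize_unit mt).
  rewrite -[t * v](subrK (a * h)); apply: idealD => //.
  by rewrite mulrC; apply: idealMl.
have gen_av x : gen v x -> gen a x.
  case=> b [s ms Jx]; exists (b * h), (t * s); first exact: prime_notinM.
  have -> : t * s * x - b * h * a =
    t * (s * x - b * v) + b * (t * v - a * h) by ring.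
  by apply: idealD => //; apply: idealMl.
have gena : gen a a.
  exists 1, 1; rewrite ?prime_notin1 // subrr; exact: ideal0.
have [|b [s ms Jb]] := maxA (gen a) _ gen_av a gena.
  exists a; split=> // p Pp; apply: regh.
  have -> : p * a * h = t * (p * v) - p * (t * v - a * h) by ring.
  by apply: idealB => //; apply: idealMl => //; apply: Pv.
apply: nJa; apply: (@localize_unit _ (t * s - b * h)).
  apply: contra (prime_notinM mt ms) => mtsbh.
  rewrite -[t * s](subrK (b * h)); apply: (idealD idm) => //.
  exact: (idealMl _ idm).
have -> : (t * s - b * h) * a =
    t * (s * a - b * v) + b * (t * v - a * h) by ring.
by apply: idealD => //; apply: idealMl.
Qed.

(** The depth is at most the dimension of the quotient by any associated prime
[Q]: for the first term [h] of the sequence, [Q] and [h] kill a common element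
modulo [gs] and [h], hence lie in an associated prime of that quotient.  It is
strictly larger than [Q], because the regular element [h] is not in [Q]. *)
Lemma regular_seq_prime_chain gs hs Q u :
    regular_seq_at m gs hs -> is_prime_ideal Q ->
    {subset Q <= m} -> {subset gs <= Q} ->
    ~ in_localized_ideal m gs u ->
    (forall q, q \in Q -> in_localized_ideal m gs (q * u)) ->
  exists2 C, prime_chain_at m gs (size hs) C & C 0%N = Q.
Proof.
elim: hs gs Q u => [|h hs IHhs] gs Q u [mhs reg_hs] prQ Qm gsQ gsu Qu.
  by exists (fun=> Q); split.
have idgs := in_ideal_of_ideal gs.
have regh f : localize m (in_ideal_of gs) (f * h) ->
  localize m (in_ideal_of gs) f.
  by have := reg_hs 0%N isT f; rewrite /= cats0.
have mh : h \in m by apply: mhs; rewrite inE eqxx.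
have [v [vgsh Qv]] := annihilated_notin_adjoin idgs mh regh gsu Qu.
have loc_rcons f : localize m (adjoin (in_ideal_of gs) h) f <->
    in_localized_ideal m (rcons gs h) f.
  by split=> -[t mt] /in_ideal_of_rcons; exists t.
have idh := ideal_adjoin h idgs; have idlh := ideal_localize idh.
have [|Q' [w [prQ' Q'm Q'P w_gsh Q'w]]] :=
    exists_associated_prime (P :=
      fun p => p \in Q \/ in_ideal_of (rcons gs h) p) idh vgsh.
  move=> p [/Qv[t mt Jp] | /in_ideal_of_rcons Jp].
    by exists t => //; apply: adjoin_sub.
  by rewrite mulrC; apply: (idealMl _ idlh); apply: localize_sub.
have [||||||C [prC ltC gsC Cm] C0] := IHhs (rcons gs h) Q' w.
- split=> [g hsg|i lt_i f].
    by apply: mhs; rewrite inE hsg orbT.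
  by have := reg_hs i.+1 lt_i f; rewrite /= cat_rcons.
- exact: prQ'.
- exact: Q'm.
- by move=> g gsg; apply: Q'P; right; apply: in_ideal_of_mem.
- by move=> /loc_rcons.
- by move=> q /Q'w/loc_rcons.
exists (fun i => if i is j.+1 then C j else Q) => //; split=> //.
- by case=> // i; apply: prC.
- case=> [_ | i]; last exact: ltC.
  rewrite C0; split=> [q Qq | Q'Q]; first by apply: Q'P; left.
  have /Q'Q/Qu : h \in Q'.
    apply: Q'P; right; apply: in_ideal_of_mem.
    by rewrite mem_rcons inE eqxx.
  by rewrite mulrC => /regh.
Qed.

End AssociatedPrimes.

(** * The length of chains of primes in a polynomial ring *)

Section ChainLength.

Variables (K : fieldType) (n : nat).
Local Notation R := {mpoly K[n]}.
Implicit Types (P Q : {pred R}) (s t : seq R).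

Lemma idealZ (J : R -> Prop) (c : K) p : ideal J -> J p -> J (c *: p).
Proof. by move=> idJ Jp; rewrite -mul_mpolyC; apply: idealMl. Qed.

Lemma mpoly_in_ideal (J : R -> Prop) p :
  ideal J -> (forall m, m \in msupp p -> J 'X_[m]) -> J p.
Proof.
move=> idJ Jp; rewrite [p]mpolyE big_seq; apply: ideal_sum => // m /Jp.
exact: idealZ.
Qed.

Lemma monomial_in_ideal (J : R -> Prop) (m m' : 'X_{1..n}) :
  ideal J -> (m <= m')%MM -> J 'X_[m] -> J 'X_[m'].
Proof.
by move=> idJ le_mm' Jm; rewrite -(submK le_mm') mpolyXD; apply: idealMl.
Qed.

Definition lin_indep_mod P s : Prop :=
  forall c : nat -> K, \sum_(i < size s) c i *: s`_i \in P ->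
  forall i, (i < size s)%N -> c i = 0.

(** Reducing a relation modulo [Q], where [f] vanishes, kills the coefficients
on [s]; what remains can be divided by [f] modulo the prime [P]. *)
Lemma lin_indep_mod_cat P Q f s t :
    is_prime_ideal P -> is_prime_ideal Q -> {subset P <= Q} ->
    f \in Q -> f \notin P -> lin_indep_mod Q s -> lin_indep_mod P t ->
  lin_indep_mod P (s ++ [seq f * p | p <- t]).
Proof.
move=> [idP prP] [idQ prQ] sPQ Qf Pf ind_s ind_t c.
have idP' := ideal_idealr idP; have idQ' := ideal_idealr idQ.
rewrite size_cat size_map big_split_ord /=.
rewrite (eq_bigr (fun i : 'I__ => c i *: s`_i)) => [|i _]; last first.
  by rewrite nth_cat ltn_ord.
pose sum_t := \sum_(i < size t) c (size s + i)%N *: t`_i.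
rewrite [X in _ + X](_ : _ = f * sum_t).
  move=> Pst.
  have cs i : (i < size s)%N -> c i = 0.
    apply: ind_s; rewrite -[X in X \in Q](addrK (f * sum_t)).
    apply: (idealB idQ'); first exact: sPQ.
    by rewrite mulrC; apply: (idealMl _ idQ').
  have ct i : (i < size t)%N -> c (size s + i)%N = 0.
    apply: (ind_t (fun i => c (size s + i)%N)).
    move: Pst; rewrite big1 ?add0r => [/prP | i' _];
      last by rewrite cs ?scale0r.
    by rewrite (negPf Pf).
  move=> i; case: (ltnP i (size s)) => [/cs // | le_si lt_i].
  by rewrite -(subnKC le_si) ct // ltn_subLR.
rewrite mulr_sumr; apply: eq_bigr => i _.
by rewrite nth_cat ltnNge leq_addr addKn (nth_map 0) // scalerAr.
Qed.

Lemma lin_indep_mod_powers P Q f s b d k :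
    is_prime_ideal P -> is_prime_ideal Q -> {subset P <= Q} ->
    f \in Q -> f \notin P -> (msize f <= d.+1)%N ->
    lin_indep_mod Q s -> {in s, forall p, msize p <= b.+1}%N ->
  exists t, [/\ lin_indep_mod P t, size t = (k * size s)%N &
                {in t, forall p, msize p <= (b + k * d).+1}%N].
Proof.
move=> prP prQ sPQ Qf Pf df ind_s bs; elim: k => [|k [t [ind_t st bt]]].
  by exists [::]; split=> // c _ i.
exists (s ++ [seq f * p | p <- t]); split;
  first exact: (lin_indep_mod_cat prP prQ).
  by rewrite size_cat size_map st mulSn.
move=> p; rewrite mem_cat => /orP[/bs | /mapP[q /bt bq ->]].
  by move/leq_trans; apply; rewrite ltnS leq_addr.
have [->|q0] := eqVneq q 0; first by rewrite mulr0 msize0.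
have f0 : f != 0 by apply: contraNneq Pf => ->; case: (proj1 prP).
rewrite msizeM //; move: df bq; rewrite mulSn; move: (msize f) (msize q) => x y.
by case: x => [|x]; case: y => [|y]; rewrite /= ?addnS /=; lia.
Qed.

(** If [f_i] is in the prime [C i.+1] and not in [C i], then [f_0, .., f_(e-1)]
are algebraically independent modulo [C 0].  The sequence built here consists
of their [k ^ e] monomials with all exponents less than [k]. *)
Lemma prime_chain_lin_indep e (C : nat -> {pred R}) :
    (forall i, (i <= e)%N -> is_prime_ideal (C i)) ->
    (forall i, (i < e)%N ->
      {subset C i <= C i.+1} /\ ~ {subset C i.+1 <= C i}) ->
  exists d, forall k, exists s,
    [/\ lin_indep_mod (C 0%N) s, size s = (k ^ e)%N &
        {in s, forall p, msize p <= (k * d).+1}%N].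
Proof.
elim: e C => [|e IHe] C prC ltC.
  exists 0%N => k; exists [:: 1]; split=> // [c|p]; last first.
    by rewrite inE => /eqP ->; rewrite msize1.
  rewrite big_ord1 /= => Cc [|//] _; have [id0 _] := prC 0%N isT.
  have [_ /negP n1 _] := id0; apply/eqP; apply: contraT => c0; case: n1.
  have := idealZ (c 0%N)^-1 (ideal_idealr id0) Cc.
  by rewrite scalerA mulVf // scale1r.
have [i lt_i | i lt_i | d IHd] := IHe (fun i => C i.+1); try exact: prC;
  try exact: ltC.
have [C01 /existsNP[f /not_implyP[C1f /negP C0f]]] := ltC 0%N isT.
exists (msize f + d)%N => k; have [s [ind_s sz_s bs]] := IHd k.
have [t [ind_t sz_t bt]] := lin_indep_mod_powers k (prC 0%N isT) (prC 1%N isT)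
  C01 C1f C0f (leqnSn _) ind_s bs.
exists t; split=> [|| p /bt] //; first by rewrite sz_t sz_s expnS.
by move/leq_trans; apply; rewrite ltnS mulnDr addnC.
Qed.

(** Modulo the variables of [S], a polynomial of degree at most [d] is a linear
combination of the monomials in the other [n - #|S|] variables with exponents
at most [d]. *)
Lemma lin_indep_mod_size P (S : {set 'I_n}) s d :
    idealr_closed P -> (forall v, v \in S -> 'X_v \in P) ->
    lin_indep_mod P s -> {in s, forall p, msize p <= d.+1}%N ->
  (size s <= d.+1 ^ (n - #|S|))%N.
Proof.
move=> idP SP ind_s bs; have idP' := ideal_idealr idP.
(* The exponents of the monomials without variables of [S] or high powers. *)
pose T := pffun_on (ord0 : 'I_d.+1) (~: S) predT.
have cardT : #|T| = (d.+1 ^ (n - #|S|))%N.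
  rewrite card_pffun_on; congr (_ ^ _)%N; first by rewrite card_ord.
  by rewrite cardsCs setCK card_ord.
rewrite leqNgt -cardT; apply/negP => gt_s.
pose mon (g : {ffun 'I_n -> 'I_d.+1}) := [multinom (g v : nat) | v < n].
pose A := \matrix_(i < size s, j < #|T|) (s`_i)@_(mon (enum_val j)).
have : kermx A != 0.
  rewrite kermx_eq0 /row_free neq_ltn.
  by rewrite (leq_ltn_trans (rank_leq_col A)).
case/rowV0Pn => c /sub_kermxP cA /eqP; case; apply/rowP => i; rewrite mxE.
pose c' k := if insub k is Some i' then c ord0 i' else 0.
have c'E (i' : 'I_(size s)) : c' i' = c ord0 i' by rewrite /c' valK.
rewrite -c'E; apply: (ind_s c') => //.
set p := \sum_(i < size s) _.
have pE m : p@_m = \sum_(i < size s) c ord0 i * (s`_i)@_m.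
  by rewrite /p raddf_sum /=; apply: eq_bigr => k _; rewrite mcoeffZ c'E.
apply: (mpoly_in_ideal idP') => m m_p.
have [/exists_inP[v Sv mv] | /exists_inPn mS] :=
  boolP [exists v in S, m v != 0%N].
  by apply: (monomial_in_ideal idP' (m := U_(v))); rewrite ?lep1mP ?SP.
suff pm0 : p@_m = 0 by rewrite mcoeff_msupp pm0 eqxx in m_p.
have [le_md | lt_dm] := leqP (mdeg m) d; last first.
  rewrite pE big1 // => k _; rewrite memN_msupp_eq0 ?mulr0 //.
  by rewrite msize_mdeg_ge // (leq_trans (bs _ _)) // mem_nth.
have lt_m v : (m v < d.+1)%N.
  by rewrite ltnS (leq_trans _ le_md) // mdegE (bigD1 v) //= leq_addr.
pose g := [ffun v => Ordinal (lt_m v)].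
have gT : g \in T.
  apply/pffun_onP; split=> // ; apply/supportP => v.
  rewrite inE negbK ffunE => /mS; rewrite negbK => /eqP mv0.
  exact: val_inj.
have := congr1 (fun B : 'rV_#|T| => B ord0 (enum_rank_in gT g)) cA.
rewrite !mxE => <-; rewrite pE; apply: eq_bigr => k _.
rewrite mxE enum_rankK_in //; congr (_ * mcoeff _ _).
by apply/mnmP => v; rewrite mnmE ffunE.
Qed.

(** If [e > r], where [r := n - #|S|], then the [k ^ e] independent polynomials
of degree at most [k * d] outgrow the [(k * d + 1) ^ r] monomials available to
them; [k := d.+1 ^ r + 1] is already large enough. *)
Lemma prime_chain_length e (C : nat -> {pred R}) (S : {set 'I_n}) :
    (forall i, (i <= e)%N -> is_prime_ideal (C i)) ->
    (forall i, (i < e)%N ->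
      {subset C i <= C i.+1} /\ ~ {subset C i.+1 <= C i}) ->
    (forall v, v \in S -> 'X_v \in C 0%N) ->
  (e <= n - #|S|)%N.
Proof.
move=> prC ltC SC; have [d indC] := prime_chain_lin_indep prC ltC.
rewrite leqNgt; apply/negP; set r := (n - #|S|)%N => lt_re.
have [s [ind_s sz_s bs]] := indC (d.+1 ^ r).+1;
  set k := (d.+1 ^ r).+1 in sz_s bs.
have := lin_indep_mod_size (proj1 (prC 0%N isT)) SC ind_s bs.
rewrite -/r sz_s; apply/negP; rewrite -ltnNge.
apply: leq_trans (leq_pexp2l _ lt_re) => //; rewrite expnS.
apply: (@leq_ltn_trans ((k * d.+1) ^ r)).
  by case: (r) => // r'; rewrite leq_exp2r //; lia.
by rewrite expnMn mulnC ltn_mul2r expn_gt0 /=.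
Qed.

End ChainLength.

(** * The Nullstellensatz *)

Section Zariski.

Section Integrality.

Variables (A : comNzRingType) (L : fieldType) (phi : {rmorphism A -> L}).

Lemma horner_map_coef N (p : {poly A}) x : (size p <= N)%N ->
  (map_poly phi p).[x] = \sum_(i < N) phi p`_i * x ^+ i.
Proof.
move=> le_pN; rewrite (horner_coef_wide _ (leq_trans (size_poly _ _) le_pN)).
by apply: eq_bigr => i _; rewrite coef_map.
Qed.

(** Multiplying the relation by the power [a N ^ (N - 1)] of its leading
coefficient makes it a monic relation for [a N * x]. *)
Lemma integral_leading_scale N (a : nat -> A) x :
  \sum_(i < N.+1) phi (a i) * x ^+ i = 0 -> integralOver phi (phi (a N) * x).
Proof.
case: N => [|N].
  by rewrite big_ord1 expr0 mulr1 => ->; rewrite mul0r; apply: integral0.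
rewrite big_ord_recr /= => sum0; set c := a N.+1.
pose r := \poly_(i < N.+1) (a i * c ^+ (N - i)).
have size_r : (size r < size ('X^(N.+1) : {poly A}))%N.
  by rewrite size_polyXn ltnS size_poly.
exists ('X^(N.+1) + r); first by rewrite monicE lead_coefDl // lead_coefXn.
rewrite rmorphD /= map_polyXn /root hornerD hornerXn; apply/eqP.
rewrite (horner_map_coef _ (size_poly _ _)).
transitivity
  (phi c ^+ N * (\sum_(i < N.+1) phi (a i) * x ^+ i + phi c * x ^+ N.+1)).
  rewrite mulrDr addrC mulr_sumr; congr (_ + _).
    apply: eq_bigr => i _; rewrite coef_poly ltn_ord rmorphM rmorphXn /=.
    have -> : phi c ^+ N = phi c ^+ (N - i) * phi c ^+ i.
      by rewrite -exprD subnK // -ltnS.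
    by rewrite exprMn; ring.
  by rewrite exprMn exprSr mulrA.
by rewrite sum0 mulr0.
Qed.

(** Integrality over the localization of [A] at the powers of [c], expressed
over [A] itself. *)
Definition almost_integral c x := exists k, integralOver phi (phi c ^+ k * x).

Lemma integral_id_mul a x : integralOver phi x -> integralOver phi (phi a * x).
Proof. by apply: integral_mul; apply: integral_id. Qed.

Lemma almost_integral_id c a : almost_integral c (phi a).
Proof. by exists 0%N; rewrite mul1r; apply: integral_id. Qed.

Lemma almost_integralMr c d x :
  almost_integral c x -> almost_integral (c * d) x.
Proof.
case=> k int_x; exists k; rewrite rmorphM exprMn mulrAC mulrC -rmorphXn.
exact: integral_id_mul.
Qed.

Lemma almost_integralD c x y :
  almost_integral c x -> almost_integral c y -> almost_integral c (x + y).
Proof.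
case=> [j int_x] [k int_y]; exists (j + k)%N; rewrite exprD.
have -> : phi c ^+ j * phi c ^+ k * (x + y) =
  phi (c ^+ k) * (phi c ^+ j * x) + phi (c ^+ j) * (phi c ^+ k * y).
  by rewrite !rmorphXn; ring.
by apply: integral_add; apply: integral_id_mul.
Qed.

Lemma almost_integralM c x y :
  almost_integral c x -> almost_integral c y -> almost_integral c (x * y).
Proof.
case=> [j int_x] [k int_y]; exists (j + k)%N; rewrite exprD mulrACA.
exact: integral_mul.
Qed.

Lemma almost_integralX c x k :
  almost_integral c x -> almost_integral c (x ^+ k).
Proof.
move=> int_x; elim: k => [|k IHk].
  by rewrite expr0 -(rmorph1 phi); apply: almost_integral_id.
by rewrite exprS; apply: almost_integralM.
Qed.

Lemma almost_integral_horner c x (p : {poly A}) :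
  almost_integral c x -> almost_integral c (map_poly phi p).[x].
Proof.
move=> int_x; elim/poly_ind: p => [|p a IHp].
  by rewrite rmorph0 horner0 -(rmorph0 phi); apply: almost_integral_id.
rewrite rmorphD rmorphM /= map_polyX map_polyC hornerMXaddC.
apply: almost_integralD; last exact: almost_integral_id.
exact: almost_integralM.
Qed.

(** Read backwards, an integral equation of [y] with lowest nonzero coefficient
[d] is an algebraic equation of [y^-1] with leading coefficient [d]. *)
Lemma integral_inverse y : integralOver phi y -> y != 0 ->
  exists2 d, phi d != 0 & integralOver phi (phi d / y).
Proof.
case=> q mon_q; rewrite /root (horner_map_coef _ (leqnn _)) => /eqP qy0 y0.
have q0 : q != 0 by apply: monic_neq0.
set N := (size q).-1; have sizeq : size q = N.+1 by rewrite polySpred.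
have exj : exists j, (j <= N)%N && (phi q`_j != 0).
  by exists N; rewrite leqnn -lead_coefE (monicP mon_q) rmorph1 oner_neq0.
case: (ex_minnP exj) => j /andP[le_jN qj0] min_j.
have low0 i : (i < j)%N -> phi q`_i = 0.
  move=> lt_ij; apply/eqP; apply: contraTT lt_ij => qi0; rewrite -leqNgt.
  by have [le_iN|/ltnW/(leq_trans le_jN)//] := leqP i N; apply: min_j;
    rewrite le_iN.
exists q`_j => //; have -> : j = (N - (N - j))%N by rewrite subKn.
apply: (integral_leading_scale (a := fun l => q`_(N - l))).
have y_unit k : y ^+ k != 0 by rewrite expf_neq0.
apply: (mulfI (y_unit N)); rewrite mulr0 mulr_sumr -[RHS]qy0 sizeq.
rewrite (reindex_inj rev_ord_inj) /=.
rewrite -(big_mkord xpredT (fun l =>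
  y ^+ N * (phi q`_(N - ((N - j).+1 - l.+1)) * y^-1 ^+ ((N - j).+1 - l.+1)))).
rewrite -(big_mkord xpredT (fun i => phi q`_i * y ^+ i)).
rewrite [RHS](big_cat_nat (n := j)) //=; last exact: leqW.
have -> : \sum_(0 <= i < j) phi q`_i * y ^+ i = 0.
  rewrite big_nat_cond big1 // => i /andP[/andP[_ lt_ij] _].
  by rewrite low0 ?mul0r.
rewrite add0r.
rewrite -[X in _ = \sum_(X <= _ < _) _]add0n big_addn subSn //;
  apply: eq_big_nat => l /andP[_ lt_l].
have -> : (N - ((N - j).+1 - l.+1) = l + j)%N by lia.
have {1}-> : N = ((l + j) + ((N - j).+1 - l.+1))%N by lia.
by rewrite exprD exprVn mulrACA mulfV ?mulr1 ?y_unit // mulrC.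
Qed.

End Integrality.

Lemma size_1DXM (L : idomainType) (s : {poly L}) :
  s != 0 -> size (1 + 'X * s) = (size s).+1.
Proof.
move=> s0; rewrite addrC mulrC size_polyDl size_mulX // size_poly1 ltnS.
by rewrite lt0n size_poly_eq0.
Qed.

Lemma one_addXM_ndiv_expr (L : fieldType) (s c : {poly L}) k :
  s != 0 -> (1 + 'X * s) * c != s ^+ k.
Proof.
move=> s0; apply/eqP => def_sk.
have co_s : coprimep (1 + 'X * s) s.
  by apply/Bezout_coprimepP; exists (1, - 'X); rewrite mul1r mulNr addrK eqpxx.
have : coprimep (1 + 'X * s) (1 + 'X * s).
  by apply: coprimep_dvdl (coprimep_expr k co_s); rewrite -def_sk dvdp_mulr.
by rewrite coprimepp size_1DXM // eqSS size_poly_eq0 (negPf s0).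
Qed.

(** The image of [A] is a Goldman domain: inverting the single element [phi s]
turns it into its field of fractions. *)
Definition goldman (A : comNzRingType) (L : fieldType)
    (phi : {rmorphism A -> L}) : Prop :=
  exists2 s, phi s != 0 &
    forall a, phi a != 0 -> exists k b, phi (a * b) = phi s ^+ k.

(** If [A[b]] becomes a field on inverting [s], then [b] is algebraic over [A],
since otherwise the element [1 + b * s] could not divide a power of [s].  Then
[b] is integral after inverting some [c] in [A], and [s^-1] after inverting some
further [d].  The inverse of a nonzero [a] in [A] lies in [A[b, s^-1]], hence is
integral after inverting [c * d], and clearing denominators in its integral
equation shows that [a] divides a power of [c * d]. *)
Lemma goldman_horner (A : comNzRingType) (L : fieldType)
    (phi : {rmorphism A -> L}) b (cfb : commr_rmorph phi b) :
  goldman (horner_morph cfb) -> goldman phi.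
Proof.
case=> s psi_s0 psi_div; pose sb := (map_poly phi s).[b].
have sb0 : sb != 0 := psi_s0.
have div_s a : (map_poly phi a).[b] != 0 ->
  exists k c, (map_poly phi (a * c)).[b] = sb ^+ k := psi_div a.
have s0 : map_poly phi s != 0.
  apply/eqP => /(congr1 (horner_eval b)) smap0; case/eqP: sb0; move: smap0.
  by rewrite /horner_eval horner0.
have [alg_b | trans_b] := pselect (exists2 p : {poly A},
    map_poly phi p != 0 & (map_poly phi p).[b] = 0); last first.
  have zero_b p : (map_poly phi p).[b] = 0 -> map_poly phi p = 0.
    move=> pb0; apply/eqP; apply: contra_notT trans_b => p0; by exists p.
  have [|k [c]] := div_s (1 + 'X * s).
    apply/eqP => /zero_b/eqP; rewrite rmorphD rmorph1 rmorphM /= map_polyX.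
    by rewrite -size_poly_eq0 size_1DXM.
  rewrite -horner_exp -rmorphXn /= => /eqP;
    rewrite -subr_eq0 -hornerN -hornerD -rmorphB /=.
  move=> /eqP/zero_b/eqP; rewrite rmorphB subr_eq0 rmorphXn rmorphM rmorphD
    rmorph1 rmorphM /= map_polyX.
  by rewrite (negPf (one_addXM_ndiv_expr _ _ _)).
case: alg_b => p p0 pb0.
pose N := (size (map_poly phi p)).-1; pose c := p`_N.
have size_p : size (map_poly phi p) = N.+1 by rewrite polySpred.
have c0 : phi c != 0 by rewrite -coef_map -lead_coefE lead_coef_eq0.
have int_b : almost_integral phi c b.
  exists 1%N; rewrite expr1;
    apply: (integral_leading_scale (a := fun i => p`_i)).
  rewrite -[RHS]pb0 horner_coef size_p; apply: eq_bigr => i _.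
  by rewrite coef_map.
have [M int_sb] := almost_integral_horner s int_b.
have [|d d0 int_d] := integral_inverse int_sb;
  first by rewrite mulf_neq0 ?expf_neq0.
have cd0 : phi (c * d) != 0 by rewrite rmorphM mulf_neq0.
have int_sbV : almost_integral phi (c * d) sb^-1.
  rewrite mulrC; exists 1%N; rewrite expr1.
  have -> : phi (d * c) / sb = phi (c ^+ M.+1) * (phi d / (phi c ^+ M * sb)).
    by rewrite rmorphXn rmorphM exprS; field; rewrite sb0 expf_neq0.
  exact: integral_id_mul.
exists (c * d) => // a a0.
have [|k [t def_at]] := div_s a%:P; first by rewrite map_polyC hornerC.
have int_aV : almost_integral phi (c * d) (phi a)^-1.
  have -> : (phi a)^-1 = (map_poly phi t).[b] * sb^-1 ^+ k.
    have def_sbk : phi a * (map_poly phi t).[b] = sb ^+ k.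
      by rewrite -def_at rmorphM /= hornerM map_polyC hornerC.
    by apply: (mulfI a0); rewrite mulfV // mulrA def_sbk exprVn mulfV
      ?expf_neq0.
  apply: almost_integralM; last exact: almost_integralX.
  by apply: almost_integralMr; apply: almost_integral_horner.
move: (c * d) int_aV => {cd0 int_sbV} e int_aV.
case: int_aV => [k' [r mon_r]]; set w := phi e ^+ k' / phi a.
rewrite /root (horner_map_coef phi _ (leqnn _)) polySpred ?monic_neq0 //.
set N' := (size r).-1; rewrite big_ord_recr /= -lead_coefE (monicP mon_r).
rewrite rmorph1 mul1r addrC addr_eq0 => /eqP def_w.
have aw : phi a * w = phi e ^+ k' by rewrite /w mulrCA mulfV ?mulr1.
exists (k' * N')%N; rewrite exprM -aw exprMn def_w.
exists (- \sum_(i < N') r`_i * e ^+ (k' * i) * a ^+ (N' - i.+1)).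
rewrite rmorphM rmorphN !mulrN mulr_sumr rmorph_sum mulr_sumr; congr (- _).
apply: eq_bigr => i _; rewrite !rmorphM !rmorphXn /= exprM -aw.
have -> : phi a ^+ N' = phi a * phi a ^+ (N' - i.+1) * phi a ^+ i.
  by rewrite -exprS -exprD; congr (_ ^+ _); have := ltn_ord i; lia.
by rewrite exprMn; ring.
Qed.

Definition generated_by (A : comNzRingType) (L : fieldType) (phi : A -> L)
    (bs : seq L) : Prop :=
  forall S : L -> Prop, (forall a, S (phi a)) -> (forall b, b \in bs -> S b) ->
    (forall x y, S x -> S y -> S (x + y)) ->
    (forall x y, S x -> S y -> S (x * y)) ->
  forall x, S x.

(** A field is a Goldman domain, and [goldman_horner] removes the generators one
at a time. *)
Lemma generated_goldman (A : comNzRingType) (L : fieldType)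
    (phi : {rmorphism A -> L}) bs : generated_by phi bs -> goldman phi.
Proof.
elim: bs A phi => [|b bs IHbs] A phi genL.
  have surj x : exists a, x = phi a.
    apply: (genL (fun x => exists a, x = phi a)) =>
      // [a | {}x y [a ->] [b ->] | {}x y [a ->] [b ->]]; first by exists a.
      by exists (a + b); rewrite rmorphD.
    by exists (a * b); rewrite rmorphM.
  exists 1; first by rewrite rmorph1 oner_neq0.
  move=> a a0; have [b def_b] := surj (phi a)^-1; exists 0%N, b.
  by rewrite rmorphM -def_b mulfV.
pose cfb : commr_rmorph phi b := fun a => mulrC b (phi a).
apply: (@goldman_horner _ _ _ b cfb); apply: IHbs => S Sphi Sbs SD SM.
apply: genL => // [a | b']; first by rewrite -(horner_morphC cfb); exact: Sphi.
rewrite inE => /predU1P[-> | /Sbs //].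
by rewrite -(horner_morphX cfb); exact: Sphi.
Qed.

(** [K[X]] itself is not a Goldman domain: [1 + X * s] does not divide a power
of [s]. *)
Lemma goldman_poly_root (K L : fieldType) (phi : {rmorphism {poly K} -> L}) :
  goldman phi -> exists2 q, q != 0 & phi q = 0.
Proof.
case=> s s0 div_s; apply: contrapT => inj_phi.
have phi_eq0 q : phi q = 0 -> q = 0.
  by move=> q0; apply/eqP; apply: contra_notT inj_phi => nz_q; exists q.
have nz_s : s != 0 by apply: contraNneq s0 => ->; rewrite rmorph0.
have [|k [c]] := div_s (1 + 'X * s).
  by apply/eqP => /phi_eq0/eqP; rewrite -size_poly_eq0 size_1DXM.
move/eqP; rewrite -rmorphXn -subr_eq0 -rmorphB => /eqP/phi_eq0/eqP.
by rewrite subr_eq0 (negPf (one_addXM_ndiv_expr _ _ _)).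
Qed.

Lemma residue_field (R : comNzRingType) (m : {pred R}) : is_maximal_ideal m ->
  exists (L : fieldType) (pi : {rmorphism R -> L}),
    (forall x, exists a, x = pi a) /\ forall a, (pi a == 0) = (a \in m).
Proof.
move=> maxm; have [idm prm] := is_maximal_prime maxm.
pose I : idealr R := HB.pack m (isIdealr.Build R m idm).
pose Q : comNzRingType := {ideal_quot I}.
pose pr : {rmorphism R -> Q} := \pi_{ideal_quot I}%qT.
have pi0 a : (pr a == 0 :> Q) = (a \in m).
  by rewrite -(rmorph0 pr) /pr /= -Quotient.idealrBE subr0.
have surj (x : Q) : exists a, x = pr a by exists (repr x); rewrite [RHS]reprK.
have exV (x : Q) : exists y : Q, (x != 0 -> y * x = 1) /\ (x = 0 -> y = 0).
  have [-> | x0] := eqVneq x 0; first by exists 0.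
  have [a def_x] := surj x; rewrite def_x pi0 in x0.
  have idm' := ideal_idealr idm; have idJ := ideal_adjoin a idm'.
  have [[c mc] | no_c] := pselect (exists c, 1 - c * a \in m).
    exists (pr c); split=> [_ | /eqP]; last first.
      by rewrite def_x pi0 (negPf x0).
    apply/eqP; rewrite def_x eq_sym -subr_eq0.
    by rewrite -(rmorph1 pr) -rmorphM -rmorphB pi0.
  case/negP: x0; have [_ maxm'] := maxm.
  have sub := maxm' _ (idealr_ideal idJ no_c); apply: sub;
    last exact/asboolP/adjoin_gen.
  by move=> y my; apply/asboolP/adjoin_sub.
have [inv invP] := choice exV.
have mulVf (x : Q) : x != 0 -> inv x * x = 1 by case: (invP x).
have inv0 : inv 0 = 0 by case: (invP 0) => _; apply.
pose L : fieldType := HB.pack (Quotient.quot I)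
  (GRing.ComNzRing_isField.Build Q mulVf inv0).
by exists L, pr.
Qed.

(** The residue field [L] is generated over [K[f]] by the images of the
variables, so the image of [K[f]] is a Goldman domain; hence [f] is algebraic
over [K] modulo [m]. *)
Theorem maximal_ideal_algebraic (K : fieldType) n (m : {pred {mpoly K[n]}})
    (f : {mpoly K[n]}) : is_maximal_ideal m ->
  exists2 q : {poly K}, q != 0 & (map_poly (@mpolyC n K) q).[f] \in m.
Proof.
move=> maxm; have [L [pi [surj pi0]]] := residue_field maxm.
(* [generated_goldman] is applied to the morphism from [{poly K}] to [L] that
   sends the indeterminate to the class of [f]. *)
pose phi0 : {rmorphism K -> L} := pi \o @mpolyC n K.
pose cff : commr_rmorph phi0 (pi f) := fun a => mulrC (pi f) (phi0 a).
have [|q q0 qf0] := @goldman_poly_root K L (horner_morph cff).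
  apply: (@generated_goldman _ _ _ [seq pi 'X_v | v <- enum 'I_n]).
  move=> S Sphi SX SD SM x; have [p ->] := surj x.
  have SC c : S (pi c%:MP) by have := Sphi c%:P; rewrite /= horner_morphC.
  rewrite [p]mpolyE rmorph_sum /=; apply: big_ind => [|x' y'|mon _];
    [|exact: SD|].
    by rewrite -(rmorph0 pi); have := SC 0; rewrite mpolyC0.
  rewrite -mul_mpolyC rmorphM; apply: (SM) => //.
  rewrite mpolyXE_id rmorph_prod; apply: big_ind => [|x' y'|v _]; [|exact: SM|].
    by have := SC 1; rewrite mpolyC1 rmorph1.
  have SX1 : S (pi 'X_v) by apply: SX; apply/mapP; exists v; rewrite ?mem_enum.
  elim: (mon v) => [|k IHk].
    by have := SC 1; rewrite expr0 mpolyC1.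
  by rewrite exprS rmorphM; apply: SM.
exists q => //; rewrite -pi0 -horner_map -map_poly_comp; apply/eqP.
exact: qf0.
Qed.

End Zariski.

(** * Weakly regular sequences *)

Section WeaklyRegular.

Variable R : comNzRingType.
Implicit Types (J B C P : R -> Prop) (m : {pred R}) (gs hs : seq R).

(** Regularity on [R / J] without the requirement that the quotient of [R / J]
by the sequence be nonzero. *)
Fixpoint weakly_regular J hs : Prop :=
  if hs is h :: hs' then
    (forall f, J (f * h) -> J f) /\ weakly_regular (adjoin J h) hs'
  else True.

Lemma weakly_regular_ext J J' hs : (forall f, J f <-> J' f) ->
  weakly_regular J hs -> weakly_regular J' hs.
Proof.
move=> eqJ; have -> // : J' = J.
by apply/funext => f; apply/propext; split=> /eqJ.
Qed.

Lemma weakly_regular_full J hs : (forall f, J f) -> weakly_regular J hs.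
Proof.
elim: hs J => //= h hs IHhs J Jall; split=> //; apply: IHhs => f.
by exists 0; apply: Jall.
Qed.

Lemma weakly_regular_regular_seq m gs hs : is_prime_ideal m ->
    {subset hs <= m} -> weakly_regular (in_ideal_of gs) hs ->
  regular_seq_at m gs hs.
Proof.
move=> prm mhs reg_hs; split=> // i.
elim: hs gs i {mhs} reg_hs => // h hs IHhs gs [|i] [regh reg_hs] /= lt_i f.
  by rewrite cats0 => -[t mt]; rewrite mulrA => /regh; exists t.
rewrite -cat_rcons; apply: IHhs => //.
by apply: weakly_regular_ext reg_hs => g; split=> /in_ideal_of_rcons.
Qed.

(** Multiplication by [u] gives an exact sequence from [R / P] through [R / B]
to [R / C], in which the outer modules determine the middle one.  It stays exact
modulo each term of a sequence that is weakly regular on the outer two. *)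
Lemma weakly_regular_extension B C P u hs : ideal B ->
    (forall f, C f <-> adjoin B u f) -> (forall f, P f <-> B (f * u)) ->
  weakly_regular P hs -> weakly_regular C hs -> weakly_regular B hs.
Proof.
elim: hs B C P => //= h hs IHhs B C P idB CE PE [regP wP] [regC wC].
have regB f : B (f * h) -> B f.
  move=> Bfh; have /regC/CE[a Ba] : C (f * h) by apply/CE; apply: adjoin_sub.
  have /regP/PE Bau : P (a * h).
    apply/PE; have -> : a * h * u = f * h - h * (f - a * u) by ring.
    by apply: idealB => //; apply: idealMl.
  by rewrite -[f](subrK (a * u)); apply: idealD.
split=> //; apply: IHhs wP wC; first exact: ideal_adjoin.
- move=> f; split=> [[a /CE[b Bf]] | [a [b Bf]]].
    by exists b, a; rewrite addrAC.
  by exists b; apply/CE; exists a; rewrite addrAC.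
- move=> f; split=> [[a /PE Bf] | [a Bf]].
    by exists (a * u); rewrite mulrAC -mulrBl.
  have /regC/CE[b Ba] : C (a * h).
    apply/CE; exists f; have -> : a * h - f * u = - (f * u - a * h) by ring.
    exact: idealN.
  exists b; apply/PE; have -> :
    (f - b * h) * u = (f * u - a * h) + h * (a - b * u) by ring.
  by apply: idealD => //; apply: idealMl.
Qed.

End WeaklyRegular.

Section Flows.

Variable R : comUnitRingType.
Implicit Types (J : R -> Prop) (sigma : {rmorphism R -> {poly R}}).

(** The coefficients of [p] are found to be in [J] from the top degree down: in
the coefficient of degree [i + d] of the product, where [d] is the degree of
[q], the unknown ones enter only through the term [p`_i * lead_coef q]. *)
Lemma coef_regular J (p q : {poly R}) : ideal J ->
    lead_coef q \is a GRing.unit -> (forall i, J (p * q)`_i) ->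
  forall i, J p`_i.
Proof.
move=> idJ lcq Jpq i; have [k] := ubnP (size p - i);
  elim: k i => // k IHk i lt_k.
have [le_i | lt_i] := leqP (size p) i.
  by rewrite nth_default //; apply: ideal0.
have q0 : q != 0.
  by apply: contraTneq lcq => ->; rewrite lead_coef0 unitr0.
set d := (size q).-1; have size_q : size q = d.+1 by rewrite polySpred.
suff : J (p`_i * lead_coef q).
  by move/(idealMl (lead_coef q)^-1 idJ); rewrite mulrCA mulVr ?mulr1.
have lt_id : (i < (i + d).+1)%N by rewrite ltnS leq_addr.
have := Jpq (i + d)%N; rewrite coefM (bigD1 (Ordinal lt_id)) //= addKn
  -lead_coefE.
set rest := \sum_(_ < _ | _) _ => Jsum.
rewrite -[_ * _](addrK rest); apply: idealB => //; apply: ideal_sum => // j.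
rewrite -val_eqE /= => neq_ji; have [lt_ji | le_ij] := ltnP j i.
  rewrite [q`__]nth_default ?mulr0; first exact: ideal0.
  by rewrite size_q; have := ltn_ord j; lia.
by rewrite mulrC; apply: idealMl => //; apply: IHk; lia.
Qed.

(** A morphism [sigma] to [R[X]] that gives the identity at [X = 0] is a
polynomial flow on the spectrum of [R], with time [X]; this is the condition
that the flow preserves the subscheme defined by [J]. *)
Definition flow_stable sigma J := forall f, J f -> forall i, J (sigma f)`_i.

Lemma flow_stable_ideal sigma J :
  ideal J -> ideal (fun f => forall i, J (sigma f)`_i).
Proof.
move=> idJ; split=> [i|a x y Jx Jy i].
  by rewrite rmorph0 coef0; apply: ideal0.
rewrite rmorphD rmorphM coefD coefM; apply: idealD => //.
by apply: ideal_sum => // j _; apply: idealMl.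
Qed.

Lemma flow_stable_adjoin sigma J h : ideal J -> sigma h = h%:P ->
  flow_stable sigma J -> flow_stable sigma (adjoin J h).
Proof.
move=> idJ sh stJ f [a Jf] i; exists (sigma a)`_i.
by have := stJ _ Jf i; rewrite rmorphB rmorphM sh coefB coefMC.
Qed.

(** If a flow preserves [J] and moves [h] so that [h] becomes a polynomial in
time with invertible leading coefficient, then [h] is regular modulo [J]. *)
Lemma flow_regular sigma J h f : ideal J -> (forall f, (sigma f).[0] = f) ->
  flow_stable sigma J -> lead_coef (sigma h) \is a GRing.unit ->
  J (f * h) -> J f.
Proof.
move=> idJ s0 stJ lch Jfh; rewrite -[f]s0 horner_coef0.
by apply: (coef_regular idJ lch) => i; rewrite -rmorphM; apply: stJ.
Qed.

(** The flow that moves [h v] and fixes the other terms still preserves [J]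
after the terms before [h v] have been added to it. *)
Lemma flow_weakly_regular (I : eqType) (h : I -> R) (vs : seq I) J : ideal J ->
    uniq vs ->
    (forall v, v \in vs -> exists sigma, [/\ forall f, (sigma f).[0] = f,
      flow_stable sigma J, lead_coef (sigma (h v)) \is a GRing.unit &
      forall w, w \in vs -> w != v -> sigma (h w) = (h w)%:P]) ->
  weakly_regular J [seq h v | v <- vs].
Proof.
elim: vs J => //= v vs IHvs J idJ /andP[vs_v uniq_vs] flows; split=> [f|].
  have [|sigma [s0 stJ lch _]] := flows v; first exact: mem_head.
  exact: flow_regular.
apply: IHvs => // [|w vs_w]; first exact: ideal_adjoin.
have [|sigma [s0 stJ lch fix_s]] := flows w; first by rewrite inE vs_w orbT.
exists sigma; split=> // [|w' vs_w' neq_w]; last first.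
  by apply: fix_s => //; rewrite inE vs_w' orbT.
apply: flow_stable_adjoin => //; apply: fix_s; first exact: mem_head.
by apply: contraNneq vs_v => ->.
Qed.

End Flows.

(** * Primes generated by variables *)

Section MonomialPrimes.

Variables (K : fieldType) (n : nat).
Local Notation R := {mpoly K[n]}.
Implicit Types (D S T U e : {set 'I_n}) (m : 'X_{1..n}) (f g : R).

Definition involves S m := [exists v in S, m v != 0%N].

Definition var_ideal S : {pred R} := [pred f | all (involves S) (msupp f)].

Lemma involvesP S m : reflect (exists2 v, v \in S & m v != 0%N) (involves S m).
Proof. exact: exists_inP. Qed.

Lemma involvesDr S m m' : involves S m' -> involves S (m + m')%MM.
Proof.
case/involvesP => v Sv mv; apply/involvesP; exists v => //.
by rewrite mnmDE addn_eq0 negb_and mv orbT.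
Qed.

Lemma var_idealP S f :
  reflect {in msupp f, forall m, involves S m} (f \in var_ideal S).
Proof. exact: allP. Qed.

Lemma var_ideal_ideal S : ideal (fun f => f \in var_ideal S).
Proof.
split=> [|a f g /var_idealP Sf /var_idealP Sg].
  by apply/var_idealP => m; rewrite msupp0.
apply/var_idealP => m /msuppD_le; rewrite mem_cat => /orP[|/Sg //].
by case/msuppM_le/allpairsP => -[m1 m2] /= [_ /Sf Sm2 ->]; apply: involvesDr.
Qed.

Lemma var_idealX S m : ('X_[m] \in var_ideal S) = involves S m.
Proof. by rewrite inE msuppX /= andbT. Qed.

Lemma var_idealU S v : ('X_v \in var_ideal S) = (v \in S).
Proof.
rewrite var_idealX; apply/involvesP/idP => [[w Sw]|Sv].
  by rewrite mnm1E; case: (v =P w) => // ->.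
by exists v; rewrite // mnm1E eqxx.
Qed.

Lemma involves_monomial (J : R -> Prop) S m : ideal J ->
  (forall v, v \in S -> J 'X_v) -> involves S m -> J 'X_[m].
Proof.
move=> idJ JS /involvesP[v Sv mv].
by apply: (monomial_in_ideal idJ (m := U_(v)%MM)); rewrite ?lep1mP //;
  apply: JS.
Qed.

Lemma var_ideal_min (J : R -> Prop) S f : ideal J ->
  (forall v, v \in S -> J 'X_v) -> f \in var_ideal S -> J f.
Proof.
move=> idJ JS /var_idealP Sf; apply: mpoly_in_ideal => // m /Sf.
exact: involves_monomial.
Qed.

Lemma var_idealS S T : S \subset T -> {subset var_ideal S <= var_ideal T}.
Proof.
move=> sST f; apply: (var_ideal_min (var_ideal_ideal T)) => v Sv.
by rewrite var_idealU (subsetP sST).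
Qed.

(** The substitution of zero for the variables of [S], whose kernel is
[var_ideal S]. *)
Definition kill S : R -> R :=
  mmap (@mpolyC n K) (fun v => if v \in S then 0 else 'X_v).

Lemma killX S m : kill S 'X_[m] = if involves S m then 0 else 'X_[m].
Proof.
rewrite /kill mmapX /mmap1; case: involvesP => [[v Sv mv] | Sm].
  by rewrite (bigD1 v) //= Sv expr0n (negPf mv) mul0r.
rewrite mpolyXE_id; apply: eq_bigr => v _; case: ifP => // Sv.
have [-> // | mv] := eqVneq (m v) 0%N.
by case: Sm; exists v.
Qed.

Lemma kill_eq0 S f : (kill S f == 0) = (f \in var_ideal S).
Proof.
have killE : kill S f = \sum_(m <- msupp f) f@_m *: kill S 'X_[m].
  by rewrite {1}[f]mpolyE /kill rmorph_sum /=; apply: eq_bigr => m _;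
    rewrite mmapZ mul_mpolyC.
apply/eqP/idP => [kf0 | /var_idealP Sf]; last first.
  by rewrite killE big_seq big1 // => m /Sf Sm; rewrite killX Sm scaler0.
rewrite -[f]subr0 -kf0 killE {1}[f]mpolyE -sumrB.
apply: (ideal_sum _ (var_ideal_ideal S)) => m _; rewrite -scalerBr.
apply: (idealZ _ (var_ideal_ideal S)); rewrite killX; case: ifP => Sm.
  by rewrite subr0 var_idealX.
by rewrite subrr; apply: (ideal0 (var_ideal_ideal S)).
Qed.

Lemma var_ideal_prime S : is_prime_ideal (var_ideal S).
Proof.
have [S0 idS] := var_ideal_ideal S; split; first split=> //.
  by rewrite -kill_eq0 /kill rmorph1 oner_neq0.
by move=> f g; rewrite -!kill_eq0 /kill rmorphM mulf_eq0.
Qed.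

Definition mnm_set U : 'X_{1..n} := [multinom (v \in U : nat) | v < n].

Lemma mnm_setE U : 'X_[mnm_set U] = \prod_(v in U) 'X_v :> R.
Proof.
rewrite mpolyXE_id [RHS]big_mkcond /=; apply: eq_bigr => v _.
by rewrite mnmE; case: (v \in U).
Qed.

Lemma mnm_set_le U m : reflect {in U, forall v, m v != 0%N} (mnm_set U <= m)%MM.
Proof.
apply: (iffP mnm_lepP) => le_m v => [Uv | ].
  by have := le_m v; rewrite mnmE Uv lt0n.
by rewrite mnmE; case: (boolP (v \in U)) => // /le_m; rewrite lt0n.
Qed.

Lemma involves_mnm_set S U : involves S (mnm_set U) = (S :&: U != set0).
Proof.
apply/involvesP/set0Pn => [[v Sv]|[v /setIP[Sv Uv]]]; last first.
  by exists v; rewrite // mnmE Uv.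
by rewrite mnmE; case: (boolP (v \in U)) => // Uv _; exists v; rewrite inE Sv.
Qed.

Lemma var_idealMX S m f : ~~ involves S m ->
  (f * 'X_[m] \in var_ideal S) = (f \in var_ideal S).
Proof.
move=> Sm; have [idS prS] := var_ideal_prime S; apply/idP/idP => [/prS | Sf].
  by rewrite var_idealX (negPf Sm) orbF.
by rewrite mulrC; apply: (idealMl _ (ideal_idealr idS)).
Qed.

Section Shelling.

Variables (S : nat -> {set 'I_n}) (s : nat).
Hypothesis shelling : forall i j, (i < j < s)%N -> exists v l,
  [/\ v \in S i :\: S j, (l < j)%N & S l :\: S j = [set v]].

Definition cap_var_ideal k f : Prop :=
  forall l, (l < k)%N -> f \in var_ideal (S l).

Lemma cap_var_ideal_ideal k : ideal (cap_var_ideal k).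
Proof.
split=> [l _|a f g If Ig l lt_lk]; first exact: ideal0 (var_ideal_ideal _).
have [_ idS] := var_ideal_ideal (S l).
by apply: idS; [apply: If | apply: Ig].
Qed.

(** Let [U] be the set of the vertices [v] with [S l :\: S k = [set v]] for some
[l < k].  The shelling condition says that the product [u] of the variables of
[U] is in [var_ideal (S l)] for all [l < k].  Conversely, a monomial in all
these ideals and outside [var_ideal (S k)] is divisible by [u].  So the
intersection of the first [k] ideals is generated by [u] modulo that of the
first [k.+1], and [u] has annihilator [var_ideal (S k)] there. *)
Lemma shelling_weakly_regular hs :
    (forall k, (k < s)%N -> weakly_regular (fun f =>
      f \in var_ideal (S k)) hs) ->
  weakly_regular (cap_var_ideal s) hs.
Proof.
move=> regS; suff: forall k, (k <= s)%N ->
  weakly_regular (cap_var_ideal k) hs by exact.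
elim=> [|k IHk] lt_ks; first exact: weakly_regular_full.
pose U := [set v | [exists l : 'I_k, S l :\: S k == [set v]]].
have US v : v \in U -> v \notin S k.
  rewrite inE => /existsP[l /eqP /setP/(_ v)]; rewrite !inE eqxx.
  by case: (v \in S k).
have avoidU : ~~ involves (S k) (mnm_set U).
  by apply/negP; rewrite involves_mnm_set => /set0Pn[v /setIP[Sv /US]];
    rewrite Sv.
have IU : cap_var_ideal k 'X_[mnm_set U].
  move=> i lt_ik; have lt_iks : (i < k < s)%N by rewrite lt_ik.
  have [v [l [/setDP[Siv Skv] lt_lk Sl]]] := shelling lt_iks.
  rewrite var_idealX involves_mnm_set; apply/set0Pn; exists v;
    rewrite !inE Siv /=.
  by apply/existsP; exists (Ordinal lt_lk); rewrite /= Sl.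
have divU f m : cap_var_ideal k f -> m \in msupp f -> ~~ involves (S k) m ->
    (mnm_set U <= m)%MM.
  move=> If f_m Skm; apply/mnm_set_le => v; rewrite inE => /existsP[l /eqP Sl].
  have /var_idealP/(_ m f_m)/involvesP[w Slw mw] := If l (ltn_ord l).
  have : w \in [set v].
    rewrite -Sl !inE Slw andbT; apply: contra Skm => Skw.
    by apply/involvesP; exists w.
  by rewrite inE => /eqP <-.
have idk := cap_var_ideal_ideal k.
have IE f : cap_var_ideal k.+1 f <-> cap_var_ideal k f /\ f \in var_ideal (S k).
  split=> [If | [If Skf] l]; first by split=> [l lt_lk|]; apply: If;
    rewrite ltnS // ltnW.
  by rewrite ltnS leq_eqVlt => /predU1P[-> | /If].
apply: (weakly_regular_extension (u := 'X_[mnm_set U]) (C := cap_var_ideal k)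
  (P := fun f => f \in var_ideal (S k))).
- exact: cap_var_ideal_ideal.
- move=> f; split=> [If | [a /IE[If _]]]; last first.
    by rewrite -[f](subrK (a * 'X_[mnm_set U])); apply: (idealD idk) => //;
      apply: (idealMl _ idk).
  exists (\sum_(m <- msupp f | ~~ involves (S k) m) f@_m *: 'X_[m - mnm_set U]).
  apply/IE; split; first by apply: (idealB idk) => //; apply: (idealMl _ idk).
  rewrite {1}[f]mpolyE (bigID (involves (S k))) /= mulr_suml.
  rewrite [X in _ + X - _](_ : _ = \sum_(m <- msupp f | ~~ involves (S k) m)
     f@_m *: 'X_[m - mnm_set U] * 'X_[mnm_set U]); last first.
    rewrite [LHS]big_seq_cond [RHS]big_seq_cond;
      apply: eq_bigr => m /andP[f_m Skm].
    by rewrite -scalerAl -mpolyXD submK // (divU f).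
  rewrite addrK; apply: (ideal_sum _ (var_ideal_ideal (S k))) => m Skm.
  by apply: (idealZ _ (var_ideal_ideal (S k))); rewrite var_idealX.
- move=> f; rewrite IE var_idealMX //; split=> [Skf | [] //].
  by split=> //; apply: (idealMl _ idk).
- exact: regS.
- exact/IHk/ltnW.
Qed.

End Shelling.

Section Transversals.

Variables (c : 'I_n -> 'I_n) (q : 'I_n -> {poly K}) (S : {set 'I_n}).
Hypotheses (c_idem : forall v, c (c v) = c v) (q_neq0 : forall v, q v != 0).
Hypothesis (S_inj : {in S &, injective c}).

(** The map [c] sends a vertex to the base vertex of its block. *)
Definition shift_poly v : R := (map_poly (@mpolyC n K) (q v)).['X_v - 'X_(c v)].

(** The translation of the coordinates in [D]. *)
Definition flow (D : {set 'I_n}) : {rmorphism R -> {poly R}} :=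
  mmap (polyC \o @mpolyC n K) (fun v => ('X_v)%:P + (v \in D)%:R * 'X).

Lemma flowC D a : flow D a%:MP = (a%:MP)%:P.
Proof. exact: mmapC. Qed.

Lemma flowX D v : flow D 'X_v = ('X_v)%:P + (v \in D)%:R * 'X.
Proof. by rewrite /flow /= mmapX mmap1U. Qed.

Lemma flow_at0 D f : (flow D f).[0] = f.
Proof.
rewrite {2}[f]mpolyE {1}[f]mpolyE rmorph_sum -horner_evalE rmorph_sum /=.
apply: eq_bigr => m _; rewrite mmapZ horner_evalE hornerM hornerC mul_mpolyC.
congr (_ *: _); rewrite mmapX mpolyXE_id /mmap1 horner_prod.
by apply: eq_bigr => v _;
  rewrite horner_exp hornerD hornerC hornerM hornerX mulr0 addr0.
Qed.

Lemma flow_stable_var_ideal D : [disjoint D & S] ->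
  flow_stable (flow D) (fun f => f \in var_ideal S).
Proof.
move=> disDS; pose J f := forall i, (flow D f)`_i \in var_ideal S.
have idJ : ideal J := flow_stable_ideal (flow D) (var_ideal_ideal S).
move=> f Sf; apply: (var_ideal_min idJ) Sf => v Sv i.
rewrite flowX; have /negPf -> : v \notin D.
  by apply: contraL Sv => /(disjointFr disDS) ->.
rewrite mul0r addr0 coefC; case: eqP => _;
  last exact: ideal0 (var_ideal_ideal S).
by rewrite var_idealU.
Qed.

Lemma flow_shift_poly D v : flow D (shift_poly v) =
  (map_poly (polyC \o @mpolyC n K) (q v)).[flow D ('X_v - 'X_(c v))].
Proof.
rewrite /shift_poly -horner_map -map_poly_comp; congr (horner _ _).
by apply: eq_map_poly => a; rewrite /= flowC.
Qed.

Lemma flow_shift_fixed D v : (v \in D) = (c v \in D) ->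
  flow D (shift_poly v) = (shift_poly v)%:P.
Proof.
move=> Dv; rewrite flow_shift_poly rmorphB /= !flowX Dv.
rewrite [X in horner _ X](_ : _ = ('X_v - 'X_(c v) : R)%:P); last first.
  by rewrite rmorphB /=; ring.
by rewrite map_poly_comp horner_map.
Qed.

Lemma flow_shift_unit D v : (v \in D) != (c v \in D) ->
  lead_coef (flow D (shift_poly v)) \is a GRing.unit.
Proof.
move=> Dv; pose eps : R := (v \in D)%:R - (c v \in D)%:R.
have eps_unit : eps \is a GRing.unit.
  by rewrite /eps; move: Dv; do 2!case: (_ \in D) => //;
    rewrite ?subr0 ?sub0r ?unitrN ?unitr1.
pose t : {poly R} := eps *: 'X + ('X_v - 'X_(c v))%:P.
have -> : flow D (shift_poly v) = map_poly (@mpolyC n K) (q v) \Po t.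
  rewrite flow_shift_poly map_poly_comp; congr (horner _ _).
  by rewrite rmorphB /= !flowX /t -mul_polyC /eps !rmorphB !rmorph_nat /=; ring.
have eps0 : eps != 0 by apply: contraTneq eps_unit => ->; rewrite unitr0.
have size_const : (size ('X_v - 'X_(c v) : R)%:P < size (eps *: 'X))%N.
  by rewrite size_scale // size_polyX ltnS size_polyC_leq1.
have size_t : size t = 2.
  by rewrite /t size_polyDl // size_scale // size_polyX.
rewrite lead_coef_comp ?size_t // unitrM lead_coef_map rmorph_unit /=.
  by rewrite unitrX // /t lead_coefDl // lead_coefZ lead_coefX mulr1.
by rewrite unitfE lead_coef_eq0.
Qed.

(** For [v] outside [S], translating [v] alone moves [x_v - x_(c v)] and no
other difference.  For [v] in [S], the translation has to fix [v]; translating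
all the other vertices of its block, including the base vertex, changes
[x_v - x_(c v)] by the opposite amount and again no other difference. *)
Lemma transversal_weakly_regular vs :
    uniq vs -> (forall v, v \in vs -> c v != v) ->
  weakly_regular (fun f => f \in var_ideal S) [seq shift_poly v | v <- vs].
Proof.
move=> uniq_vs vs_c; apply: flow_weakly_regular => // [|v vs_v].
  exact: var_ideal_ideal.
(* The vertices to be translated; none of them is in [S]. *)
pose D := if v \in S then [set w | (c w == c v) && (w != v)] else [set v].
exists (flow D); split.
- exact: flow_at0.
- apply: flow_stable_var_ideal; rewrite disjoints_subset; apply/subsetP => w.
  rewrite /D; case: (boolP (v \in S)) => Sv; rewrite !inE; last by move/eqP->.
  by case/andP => /eqP cwv; apply: contra => Sw; apply/eqP/S_inj.
- apply: flow_shift_unit; rewrite /D; case: (v \in S);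
    rewrite !inE ?eqxx ?andbF //.
    by rewrite c_idem eqxx vs_c.
  by rewrite (negPf (vs_c v vs_v)).
- move=> w vs_w neq_wv; apply: flow_shift_fixed.
  have cw_v : c w != v.
    by apply: contraNneq (vs_c v vs_v) => <-; rewrite c_idem.
  by rewrite /D; case: (v \in S);
    rewrite !inE ?c_idem ?(negPf neq_wv) ?(negPf cw_v) ?andbT.
Qed.

End Transversals.

End MonomialPrimes.

Arguments var_ideal K {n} S.
Arguments cap_var_ideal K {n} S k f.

(** * Edge ideals *)

Section EdgeIdeals.

Variables (K : fieldType) (n : nat) (E : {set {set 'I_n}}).
Local Notation R := {mpoly K[n]}.
Local Notation gens := (edge_ideal_gens K E).
Implicit Types (e S T : {set 'I_n}) (f : R).

Lemma min_vertex_cover_sub S : vertex_cover E S ->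
  exists2 T, min_vertex_cover E T & T \subset S.
Proof. by case/minset_exists => T minT sTS; exists T. Qed.

Lemma min_vertex_cover_private S v : min_vertex_cover E S -> v \in S ->
  exists2 e, e \in E & S :&: e = [set v].
Proof.
case/minsetP => coverS minS Sv.
have /forall_inPn[e Ee /negPn/eqP Sve] : ~~ vertex_cover E (S :\ v).
  by apply: contraL Sv => /minS/(_ (subD1set _ _)) <-; rewrite !inE eqxx.
exists e => //; apply/eqP; rewrite eqEsubset sub1set.
have sSev : S :&: e \subset [set v].
  apply/subsetP => w /setIP[Sw ew]; rewrite inE; apply: contraT => neq_wv.
  by have := in_set0 w; rewrite -Sve !inE neq_wv Sw ew.
rewrite sSev; have /set0Pn[w Sew] := forall_inP coverS e Ee.
by have := subsetP sSev w Sew; rewrite inE => /eqP <-.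
Qed.

Lemma facets_indep_complex S :
  (S \in facets (indep_complex E)) = min_vertex_cover E (~: S).
Proof.
have indepC T : (T \in indep_complex E) = vertex_cover E (~: T).
  rewrite inE; apply: eq_forallb_in => e Ee.
  by rewrite setIC setI_eq0 disjoints_subset setCK.
rewrite inE; apply/maxsetP/minsetP; rewrite indepC => -[coverS extS];
  split=> // T.
  move=> coverT sTS; apply: setC_inj; rewrite setCK; apply: extS.
    by rewrite indepC setCK.
  by rewrite -setCS setCK.
rewrite indepC => coverT sST; apply: setC_inj; apply: extS => //.
by rewrite setCS.
Qed.

Lemma mem_edge_ideal_gens g :
  reflect (exists2 e, e \in E & g = 'X_[mnm_set e]) (g \in gens).
Proof.
apply: (iffP mapP) => -[e]; first by rewrite mem_enum => Ee ->; exists e;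
  rewrite ?mnm_setE.
by move=> Ee ->; exists e; rewrite ?mem_enum ?mnm_setE.
Qed.

Lemma edge_in_ideal e m : e \in E -> (mnm_set e <= m)%MM ->
  in_ideal_of gens ('X_[m] : R).
Proof.
move=> Ee le_em; apply: (monomial_in_ideal (in_ideal_of_ideal _) le_em).
by apply: in_ideal_of_mem; apply/mem_edge_ideal_gens; exists e.
Qed.

Lemma edge_ideal_sub_var_ideal S f : vertex_cover E S ->
  in_ideal_of gens f -> f \in var_ideal K S.
Proof.
move=> /forall_inP coverS; apply: (in_ideal_of_min (var_ideal_ideal K S)).
move=> g /mem_edge_ideal_gens[e Ee ->].
by rewrite var_idealX involves_mnm_set coverS.
Qed.

(** If the support of a monomial contains no edge, then its complement is a
cover, and the monomial involves no variable of a minimal cover inside it. *)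
Lemma edge_ideal_cap f :
    (forall S, min_vertex_cover E S -> f \in var_ideal K S) ->
      in_ideal_of gens f.
Proof.
move=> fS; apply: (mpoly_in_ideal (in_ideal_of_ideal _)) => m f_m.
have [/exists_inP[e Ee le_em] | no_e] :=
  boolP [exists e in E, (mnm_set e <= m)%MM].
  exact: edge_in_ideal le_em.
have [|T minT sTZ] := @min_vertex_cover_sub [set v | m v == 0%N].
  apply/forall_inP => e Ee; apply: contra no_e => /eqP Ze; apply/exists_inP.
  exists e => //; apply/mnm_set_le => v ev; apply: contraT; rewrite negbK => mv.
  by have := in_set0 v; rewrite -Ze !inE mv ev.
have /var_idealP/(_ m f_m)/involvesP[v Tv mv] := fS T minT.
by have := subsetP sTZ v Tv; rewrite inE (negPf mv).
Qed.

Lemma prime_over_edge_ideal (P : {pred R}) :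
  is_prime_ideal P -> {subset gens <= P} ->
  exists2 S, min_vertex_cover E S & forall v, v \in S -> 'X_v \in P.
Proof.
move=> [[P0 P1 idP] prP] gP.
have [|S minS sSP] := @min_vertex_cover_sub [set v | 'X_v \in P]; last first.
  by exists S => // v /(subsetP sSP); rewrite inE.
apply/forall_inP => e Ee; have : \prod_(v in e) ('X_v : R) \in P.
  by apply: gP; apply/mem_edge_ideal_gens; exists e; rewrite ?mnm_setE.
apply: contraTneq => Pe; elim/big_ind: _ => [|f g Pf Pg|v ev] //.
  by apply/negP => /prP; rewrite (negPf Pf) (negPf Pg).
by have := in_set0 v; rewrite -Pe !inE ev andbT => ->.
Qed.

(** The first prime of the chain contains the variables of a minimal cover. *)
Lemma edge_ideal_chain_length g d (P : nat -> {pred R}) (m : {pred R}) :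
    (forall S, min_vertex_cover E S -> #|S| = g) ->
  prime_chain_at m gens d P -> (d <= n - g)%N.
Proof.
move=> cardE [prP ltP gP _].
have [S minS SP] := prime_over_edge_ideal (prP 0%N isT) gP.
by rewrite -(cardE S minS); apply: prime_chain_length prP ltP SP.
Qed.

Lemma regular_seq_exists_chain (m : {pred R}) gs hs : is_prime_ideal m ->
    {subset gs <= m} -> regular_seq_at m gs hs ->
  exists P, prime_chain_at m gs (size hs) P.
Proof.
move=> prm gm reg_hs; have idm := ideal_idealr (proj1 prm).
have J1 : ~ localize m (in_ideal_of gs) 1.
  case=> t /negP mt; rewrite mulr1 => /(in_ideal_of_min idm gm); exact: mt.
have [|Q [v [prQ Qm gQ Jv Qv]]] :=
  exists_associated_prime (mpoly_noetherian (K:=K) (n:=n))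
   prm (P := in_ideal_of gs) (in_ideal_of_ideal gs) J1.
  by move=> p Jp; apply: localize_sub => //; rewrite mulr1.
have [|P prP _] := regular_seq_prime_chain (mpoly_noetherian (K:=K) (n:=n)) prm
  reg_hs prQ Qm _ Jv Qv.
  by move=> g gsg; apply/gQ/in_ideal_of_mem.
by exists P.
Qed.

(** The hypotheses on [c] say that each minimal cover has exactly one vertex in
each fibre of [c]; the fixed points of [c] are one such transversal. *)
Theorem shellable_cohen_macaulay (c : 'I_n -> 'I_n) :
    (forall v, c (c v) = c v) ->
    (forall S, min_vertex_cover E S ->
      {in S &, injective c} /\ #|S| = #|[set v | c v == v]|) ->
    shellable (indep_complex E) ->
  cohen_macaulay_quotient gens.
Proof.
move=> c_idem coverc [F [_ facetsF shellF]] m maxm gm.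
have prm := is_maximal_prime maxm; set g := #|_| in coverc.
have card_cover S : min_vertex_cover E S -> #|S| = g by case/coverc.
have [q qP] : exists q : 'I_n -> {poly K},
    forall v, q v != 0 /\ shift_poly c q v \in m.
  have alg v : exists qv : {poly K}, qv != 0 /\
      (map_poly (@mpolyC n K) qv).['X_v - 'X_(c v)] \in m.
    by have [qv] := maximal_ideal_algebraic ('X_v - 'X_(c v)) maxm; exists qv.
  by have [q qP] := choice alg; exists q.
pose hs := [seq shift_poly c q v | v <- enum (~: [set v | c v == v])].
have sz_hs : size hs = (n - g)%N.
  by rewrite size_map -cardE cardsCs setCK card_ord.
have minF k : (k < size F)%N -> min_vertex_cover E (~: nth set0 F k).
  by move=> lt_k; rewrite -facets_indep_complex -facetsF mem_nth.
have reg_hs : regular_seq_at m gens hs.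
  apply: weakly_regular_regular_seq => //; first by move=> _ /mapP[v _ ->];
    case: (qP v).
  have /weakly_regular_ext :
    forall f, cap_var_ideal K (fun k => ~: nth set0 F k) (size F) f <->
      in_ideal_of gens f.
    move=> f; split=> [If | If k lt_k]; last first.
      by apply: edge_ideal_sub_var_ideal If; have /minsetP[] := minF k lt_k.
    apply: edge_ideal_cap => S;
      rewrite -[S]setCK -facets_indep_complex -facetsF setCK.
    by case/(nthP set0) => k lt_k def_S; rewrite -[S]setCK -def_S; apply: If.
  apply; apply: shelling_weakly_regular => [i j lt_ij | k lt_k].
    have [v [l [Fv lt_lj Fl]]] := shellF i j lt_ij.
    have setCD A B : (~: A) :\: (~: B) = B :\: A :> {set 'I_n}.
      by apply/setP => w; rewrite !inE negbK andbC.
    by exists v, l; rewrite !setCD.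
  apply: transversal_weakly_regular => // [v|||v]; first by case: (qP v).
  - by case: (coverc _ (minF k lt_k)).
  - exact: enum_uniq.
  - by rewrite mem_enum !inE.
have bound hs' : regular_seq_at m gens hs' -> (size hs' <= n - g)%N.
  by case/(regular_seq_exists_chain prm gm) =>
    P /(edge_ideal_chain_length card_cover).
exists (n - g)%N; split=> //; first by exists hs.
  by rewrite -sz_hs; apply: regular_seq_exists_chain.
by move=> d P; apply: edge_ideal_chain_length.
Qed.

Lemma irrelevant_ideal_maximal : is_maximal_ideal (var_ideal K [set: 'I_n]).
Proof.
split=> [|J idJ sJ f Jf]; first by case: (var_ideal_prime K [set: 'I_n]).
have [_ J1 _] := idJ; have idJ' := ideal_idealr idJ.
have f0 : f - (f@_0%MM)%:MP \in var_ideal K [set: 'I_n].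
  apply/var_idealP => m; rewrite mcoeff_msupp mcoeffB mcoeffC => fm.
  apply/involvesP; have [m0 | /eqP/mnmP] := eqVneq m 0%MM.
    by rewrite m0 eqxx mulr1 subrr eqxx in fm.
  by move/existsNP => [v /eqP]; rewrite mnm0E => mv; exists v; rewrite ?inE.
have Jf0 : (f@_0%MM)%:MP \in J.
  by rewrite -[_%:MP](subKr f); apply: (idealB idJ') => //; apply: sJ.
have [f00 | nz_f0] := eqVneq f@_0%MM 0;
  first by rewrite f00 mpolyC0 subr0 in f0.
case/negP: J1; have := idealZ (f@_0%MM)^-1 idJ' Jf0.
by rewrite -mul_mpolyC -mpolyCM mulVf // mpolyC1.
Qed.

(** The witness is the product [u] of the variables outside [S].  Each [v] in
[S] has an edge that meets [S] only in [v], so ['X_v * u] is divisible by the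
monomial of that edge. *)
Lemma min_vertex_cover_annihilator S : min_vertex_cover E S ->
  exists u : R,
    ~ in_localized_ideal (var_ideal K [set: 'I_n]) gens u /\
    forall p, p \in var_ideal K S -> in_ideal_of gens (p * u).
Proof.
move=> minS; have /minsetP[/forall_inP coverS _] := minS.
exists 'X_[mnm_set (~: S)]; split.
  case=> t t0 /(edge_ideal_sub_var_ideal (S := S)).
  rewrite var_idealMX => [St|]; last by rewrite involves_mnm_set setICr eqxx.
  by case/negP: t0; apply: (var_idealS (subsetT S)); apply: St;
    apply/forall_inP.
have idJ : ideal (fun p : R => in_ideal_of gens (p * 'X_[mnm_set (~: S)])).
  have idI := in_ideal_of_ideal gens; split=> [|a x y Ix Iy].
    by rewrite mul0r; apply: ideal0.
  by rewrite mulrDl -mulrA; apply: idealD => //; apply: idealMl.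
move=> p; apply: (var_ideal_min idJ) => v Sv.
have [e Ee Sev] := min_vertex_cover_private minS Sv.
rewrite -mpolyXD; apply: edge_in_ideal Ee _; apply/mnm_set_le => w ew.
rewrite mnmDE mnm1E mnmE inE; have [_ // | neq_vw] := eqVneq v w.
have [Sw | //] := boolP (w \in S).
by have := in_set1 w v; rewrite -Sev inE Sw ew eq_sym (negPf neq_vw).
Qed.

(** At the origin, each minimal cover [S] bounds the depth above and the
dimension below by the same number [n - #|S|]. *)
Theorem cohen_macaulay_unmixed : cohen_macaulay_quotient gens -> unmixed E.
Proof.
move=> CM S1 S2 minS1 minS2; set m := var_ideal K [set: 'I_n].
have maxm : is_maximal_ideal m := irrelevant_ideal_maximal.
have coverT S : min_vertex_cover E S -> vertex_cover E [set: 'I_n].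
  case/minsetP => /forall_inP coverS _; apply/forall_inP => e /coverS.
  by apply: contraNneq; rewrite setTI => ->; rewrite setI0.
have gm : {subset gens <= m}.
  move=> g gsg; apply: edge_ideal_sub_var_ideal (coverT S1 minS1) _.
  exact: in_ideal_of_mem.
have [d [[hs reg_hs sz_hs] _] [_ dim_d]] := CM m maxm gm.
have gS S : min_vertex_cover E S -> {subset gens <= var_ideal K S}.
  move=> /minsetP[coverS _] g gsg; apply: edge_ideal_sub_var_ideal => //.
  exact: in_ideal_of_mem.
suff cardS S : min_vertex_cover E S -> d = (n - #|S|)%N.
  have le_n S : (#|S| <= n)%N by rewrite -[X in (_ <= X)%N]card_ord max_card.
  have := cardS _ minS1; rewrite (cardS _ minS2).
  by move: (le_n S1) (le_n S2); lia.
move=> minS; apply/eqP; rewrite eqn_leq; apply/andP; split.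
  have [u [Iu Su]] := min_vertex_cover_annihilator minS.
  have prm := is_maximal_prime maxm.
  have [|C [prC ltC _ _] C0] :=
    regular_seq_prime_chain (mpoly_noetherian (K:=K) (n:=n)) prm
    reg_hs (var_ideal_prime K S) (var_idealS (subsetT S)) (gS S minS) Iu.
    by move=> q /Su Iq; apply: localize_sub.
  rewrite -sz_hs; apply: (prime_chain_length prC ltC) => v Sv.
  by rewrite C0 var_idealU.
pose r := enum (~: S); pose T i := S :|: [set v in take i r].
have sz_r : size r = (n - #|S|)%N by rewrite -cardE cardsCs setCK card_ord.
apply: (dim_d _ (fun i => var_ideal K (T i))); split=> [i _|i lt_i|g gsg|].
- exact: var_ideal_prime.
- rewrite -sz_r in lt_i; have [x0 _] : exists x0 : 'I_n, x0 \in r.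
    move: (leq_ltn_trans (leq0n i) lt_i); case: (r) => // x0 r' _; exists x0;
      apply: mem_head.
  have takeS : take i.+1 r = rcons (take i r) (nth x0 r i).
    by rewrite (take_nth x0).
  split; first by apply: var_idealS; apply: setUS; apply/subsetP => v;
    rewrite !inE takeS mem_rcons inE orbC => ->.
  move/(_ 'X_(nth x0 r i));
    rewrite !var_idealU !inE takeS mem_rcons mem_head orbT.
  move/(_ isT); have := mem_nth x0 lt_i; rewrite mem_enum inE => /negPf ->.
  rewrite /= => r_i; have := enum_uniq (~: S);
    rewrite -/r -(cat_take_drop i.+1 r) takeS.
  by rewrite cat_uniq rcons_uniq r_i.
- exact: var_idealS (subsetUl _ _) _ (gS S minS g gsg).
- exact: var_idealS (subsetT _).
Qed.

End EdgeIdeals.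

(** * Clutters *)

Local Open Scope nat_scope.

Section Combinatorics.

Variables (n : nat) (E : {set {set 'I_n}}).
Implicit Types (M : {set {set 'I_n}}) (e f h S T A : {set 'I_n}).
Implicit Types (v w x y : 'I_n).

(** The cycle [vs 0, es 1, vs 1, es 2, ..] in which each vertex lies in exactly
two of the edges: the edge with the same index and the next one, modulo [k].
For [k > 2] this forces the vertices and the edges to be distinct. *)
Lemma has_cycle_cyclic k (vs : 'I_k -> 'I_n) (es : 'I_k -> {set 'I_n}) :
    2 < k -> (forall j, es j \in E) ->
    (forall i j, (vs i \in es j) = (j == i) || (j == ordS i)) ->
  has_cycle E k.
Proof.
move=> gt2k Ees inc; split=> //; pose j0 : 'I_k := Ordinal (ltnW (ltnW gt2k)).
pose cols j := enum_rank_in (Ees j0) (es j).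
have enumE j : enum_val (cols j) = es j by rewrite enum_rankK_in.
have ordSE (i : 'I_k) : ordS i = (if i.+1 == k then 0 else i.+1) :> nat.
  by rewrite /=; case: eqP => [->|/eqP neq_ik];
    rewrite ?modnn // modn_small // ltn_neqAle neq_ik ltn_ord.
have ordS1 (i : 'I_k) : (ordS i == i) = false.
  by apply/eqP => /(congr1 (@nat_of_ord k)); rewrite ordSE; case: eqP; lia.
have ordS2 (i : 'I_k) : (ordS (ordS i) == i) = false.
  apply/eqP => /(congr1 (@nat_of_ord k)); rewrite !ordSE.
  by do 2!case: eqP; lia.
(* Two indices that are both each other's index or successor are equal. *)
have no_flip (i j : 'I_k) :
  (j == i) || (j == ordS i) -> (i == j) || (i == ordS j) -> i = j.
  case/orP => /eqP -> //; rewrite [_ == ordS i]eq_sym ordS1 /=.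
  by rewrite eq_sym ordS2.
exists vs, cols; rewrite /=; split.
- move=> i i' eq_vs; apply: no_flip; first by rewrite -inc eq_vs inc eqxx.
  by rewrite -inc -eq_vs inc eqxx.
- move=> j j' /(congr1 enum_val); rewrite !enumE => eq_es; apply: no_flip.
    by rewrite -inc -eq_es inc eqxx.
  by rewrite -inc eq_es inc eqxx.
- move=> i; rewrite -(_ : #|[set i; ordS i]| = 2);
    last by rewrite cards2 eq_sym ordS1.
  by apply: eq_card => j; rewrite !inE !mxE enumE inc eqb1.
- move=> j; rewrite -(_ : #|[set j; ord_pred j]| = 2).
    apply: eq_card => i; rewrite !inE !mxE enumE inc eqb1 eq_sym;
      congr (_ || _).
    by rewrite -[X in X == ordS i]ord_predK (inj_eq (@ordS_inj k)) eq_sym.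
  by rewrite cards2 -(inj_eq (@ordS_inj k)) ord_predK ordS1.
Qed.

Lemma has_cycle3 e0 e1 e2 v0 v1 v2 : e0 \in E -> e1 \in E -> e2 \in E ->
    v0 \in e0 :&: e1 :\: e2 -> v1 \in e1 :&: e2 :\: e0 ->
    v2 \in e2 :&: e0 :\: e1 ->
  has_cycle E 3.
Proof.
move=> E0 E1 E2; rewrite !inE.
case/and3P=> /negPf v02 v00 v01 /and3P[/negPf v10 v11 v12].
case/and3P=> /negPf v21 v22 v20.
apply: (@has_cycle_cyclic _
  (tnth [tuple v0; v1; v2]) (tnth [tuple e0; e1; e2])) => //.
  by case=> -[|[|[|//]]] ltj; rewrite (tnth_nth set0).
case=> -[|[|[|//]]] lti [] [|[|[|//]]] ltj;
  rewrite (tnth_nth v0) (tnth_nth set0) -!val_eqE /= ?modnn ?modn_small //.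
Qed.

Lemma has_cycle4 e0 e1 e2 e3 v0 v1 v2 v3 :
    e0 \in E -> e1 \in E -> e2 \in E -> e3 \in E ->
    [&& v0 \in e0, v0 \in e1, v0 \notin e2 & v0 \notin e3] ->
    [&& v1 \in e1, v1 \in e2, v1 \notin e3 & v1 \notin e0] ->
    [&& v2 \in e2, v2 \in e3, v2 \notin e0 & v2 \notin e1] ->
    [&& v3 \in e3, v3 \in e0, v3 \notin e1 & v3 \notin e2] ->
  has_cycle E 4.
Proof.
move=> E0 E1 E2 E3 /and4P[v00 v01 /negPf v02 /negPf v03].
move=> /and4P[v11 v12 /negPf v13 /negPf v10] /and4P[v22 v23 /negPf v20 /negPf
  v21].
move=> /and4P[v33 v30 /negPf v31 /negPf v32].
apply: (@has_cycle_cyclic _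
  (tnth [tuple v0; v1; v2; v3]) (tnth [tuple e0; e1; e2; e3])) => //.
  by case=> -[|[|[|[|//]]]] ltj; rewrite (tnth_nth set0).
by case=> -[|[|[|[|//]]]] lti [] [|[|[|[|//]]]] ltj;
  rewrite (tnth_nth v0) (tnth_nth set0) -!val_eqE.
Qed.

Lemma min_vertex_cover_avoiding A : (forall e, e \in E -> ~~ (e \subset A)) ->
  exists2 S, min_vertex_cover E S & [disjoint S & A].
Proof.
move=> noA; have [|S minS sSA] := @min_vertex_cover_sub _ E (~: A).
  by apply/forall_inP => e /noA; rewrite setIC setI_eq0 disjoints_subset setCK.
by exists S; rewrite // disjoints_subset.
Qed.

Lemma min_vertex_cover_hits S e : min_vertex_cover E S -> e \in E ->
  exists2 v, v \in S & v \in e.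
Proof.
by case/minsetP => /forall_inP coverS _ /coverS/set0Pn[v /setIP[]]; exists v.
Qed.

(** Suppose that [f1] contains [x] and [f2] contains [y] in [e], but not
conversely.  A minimal cover that avoids [(f1 :\ x) :|: (f2 :\ y)] would contain
both [x] and [y], so there is an edge [h] inside that set.  It contains some [a]
in [f2] and not [f1], and some [b] in [f1] and not [f2].  If neither is in [e],
then [e, f1, h, f2] is a cycle of length 4 through [x, b, a, y].  If one is and
the other is not, then one of [f1], [f2] can be left out.  If both are in [e],
then a vertex of [h] outside [e] gives a cycle of length 3. *)
Lemma nested_edges e f1 f2 :
  is_clutter E -> ~ has_cycle E 3 -> ~ has_cycle E 4 ->
    e \in E -> f1 \in E -> f2 \in E ->
    (forall S, min_vertex_cover E S -> {in S :&: e &, forall x y, x = y}) ->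
  (f1 :&: e \subset f2 :&: e) \/ (f2 :&: e \subset f1 :&: e).
Proof.
move=> clutE no3 no4 Ee Ef1 Ef2 oneS.
apply/orP; rewrite -[_ || _]negbK negb_or; apply/negP => /andP[].
case/subsetPn => x /setIP[f1x ex]; rewrite inE ex andbT => f2x.
case/subsetPn => y /setIP[f2y ey]; rewrite inE ey andbT => f1y.
pose A := (f1 :\ x) :|: (f2 :\ y).
have [h Eh shA] : exists2 h, h \in E & h \subset A.
  apply/exists_inP; rewrite -[[exists _ in _, _]]negbK negb_exists_in;
    apply/forall_inP.
  case/min_vertex_cover_avoiding => S minS disSA.
  have pick f z : f \in E -> f :\ z \subset A -> z \in S.
    move=> Ef sfA; have [v Sv fv] := min_vertex_cover_hits minS Ef.
    have [<- //|neq_vz] := eqVneq v z; have := disjointFr disSA Sv.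
    by rewrite (subsetP sfA) // !inE neq_vz.
  have eq_xy : x = y.
    by apply: (oneS S minS); rewrite inE ?ex ?ey andbT;
      [apply: (pick f1) | apply: (pick f2)]; rewrite ?subsetUl ?subsetUr.
  by rewrite eq_xy f2y in f2x.
have hA z : z \in h -> (z != x) && (z \in f1) || (z != y) && (z \in f2).
  by move/(subsetP shA); rewrite !inE.
have hx : x \notin h by apply/negP => /hA; rewrite eqxx (negPf f2x) andbF.
have hy : y \notin h by apply/negP => /hA; rewrite eqxx (negPf f1y) andbF.
have h12 z : z \in h -> (z \in f1) || (z \in f2).
  by move/hA; do 2!case: (z \in _); rewrite ?andbF.
have not_sub f z : f \in E -> z \in f -> z \notin h -> ~~ (h \subset f).
  by move=> Ef fz; apply: contra => /(clutE _ _ Eh Ef) ->.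
have /subsetPn[a ha f1a] := not_sub f1 x Ef1 f1x hx.
have /subsetPn[b hb f2b] := not_sub f2 y Ef2 f2y hy.
have f2a : a \in f2 by have := h12 a ha; rewrite (negPf f1a).
have f1b : b \in f1 by have := h12 b hb; rewrite (negPf f2b) orbF.
have [ea | ea] := boolP (a \in e); have [eb | eb] := boolP (b \in e).
- have /subsetPn[z hz ez] := not_sub e x Ee ex hx.
  have [f1z | f1z] := boolP (z \in f1); have [f2z | f2z] := boolP (z \in f2).
  + by apply: no3; apply: (has_cycle3 (v0 := x) (v1 := z) (v2 := y) Ee Ef1 Ef2);
      rewrite !inE ?ex ?ey ?f1x ?f2y ?f1z ?f2z ?ez ?f2x ?f1y.
  + by apply: no3; apply: (has_cycle3 (v0 := x) (v1 := z) (v2 := a) Ee Ef1 Eh);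
      rewrite !inE ?ex ?f1x ?hx ?f1z ?hz ?ez ?ha ?ea ?f1a.
  + by apply: no3; apply: (has_cycle3 (v0 := y) (v1 := z) (v2 := b) Ee Ef2 Eh);
      rewrite !inE ?ey ?f2y ?hy ?f2z ?hz ?ez ?hb ?eb ?f2b.
  + by have := h12 z hz; rewrite (negPf f1z) (negPf f2z).
- by apply: no3; apply: (has_cycle3 (v0 := x) (v1 := b) (v2 := a) Ee Ef1 Eh);
    rewrite !inE ?ex ?f1x ?hx ?f1b ?hb ?eb ?ha ?ea ?f1a.
- by apply: no3; apply: (has_cycle3 (v0 := y) (v1 := a) (v2 := b) Ee Ef2 Eh);
    rewrite !inE ?ey ?f2y ?hy ?f2a ?ha ?ea ?hb ?eb ?f2b.
- by apply: no4; apply: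
      (has_cycle4 (v0 := x) (v1 := b) (v2 := a) (v3 := y) Ee Ef1 Eh Ef2);
    rewrite ?ex ?ey ?f1x ?f2y ?f1a ?f2a ?f1b ?f2b ?ha ?hb ?ea ?eb ?hx ?hy;
    rewrite ?f2x ?f1y.
Qed.

Definition nested_in e := forall f1 f2, f1 \in E -> f2 \in E ->
  (f1 :&: e \subset f2 :&: e) \/ (f2 :&: e \subset f1 :&: e).

Definition star v := [set f in E | v \in f].

(** Within a nested block the edge sets of the vertices form a chain, so they
are compared by their sizes. *)
Lemma nested_star e v w : nested_in e -> v \in e -> w \in e ->
  #|star w| <= #|star v| -> star w \subset star v.
Proof.
move=> nest ev ew le_wv; apply/subsetP => f; rewrite !inE => /andP[Ef fw].
rewrite Ef; apply: contraLR le_wv => /= fv; rewrite -ltnNge; apply: proper_card.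
apply/properP; split; last by exists f; rewrite !inE Ef // (negPf fv).
apply/subsetP => f'; rewrite !inE => /andP[Ef' fv']; rewrite Ef'.
have [/subsetP/(_ w)|/subsetP/(_ v)] := nest f f' Ef Ef';
  rewrite !inE ?ew ?ev ?andbT.
  exact.
by rewrite fv' (negPf fv) => /(_ isT).
Qed.

(** Each edge through a vertex of [e] with the fewest edges contains the whole
of [e], hence equals [e]. *)
Lemma nested_free_vertex e :
  is_clutter E -> nested_in e -> e \in E -> e != set0 ->
  exists2 v, v \in e & free_vertex E v.
Proof.
move=> clutE nest Ee /set0Pn[v0 ev0].
have [v ev min_v] := arg_minnP (fun v => #|star v|) ev0.
exists v => //; rewrite /free_vertex -/(star v).
suff -> : star v = [set e] by rewrite cards1.
apply/setP => f; rewrite !inE; apply/andP/eqP => [[Ef fv] | ->]; last by [].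
apply/esym/clutE => //; apply/subsetP => w ew.
have /subsetP/(_ f) := nested_star nest ew ev (min_v w ew).
by rewrite !inE Ef fv => /(_ isT).
Qed.

(** Choosing a point of [S] in each of the disjoint members of [M] injects [M]
into [S]; as [S] is no larger than [M], it consists of the chosen points. *)
Lemma transversal_of_card M S : trivIset M -> #|S| <= #|M| ->
    (forall e, e \in M -> exists2 v, v \in S & v \in e) ->
  S \subset cover M /\ forall e, e \in M -> {in S :&: e &, forall x y, x = y}.
Proof.
move=> /trivIsetP trivM leSM hitS.
have [M0 | /set0Pn[e0 Me0]] := eqVneq M set0.
  move: leSM; rewrite M0 cards0 leqn0 cards_eq0 => /eqP ->; split=> [|e].
    exact: sub0set.
  by rewrite inE.
have [v0 _ _] := hitS e0 Me0.
pose p e := odflt v0 [pick v in S :&: e].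
have pP e : e \in M -> (p e \in S) /\ (p e \in e).
  move=> Me; rewrite /p; case: pickP => [v /setIP[] // | no_v].
  by have [v Sv ev] := hitS e Me; have := no_v v; rewrite !inE Sv ev.
have same e e' v : e \in M -> e' \in M -> v \in e -> v \in e' -> e = e'.
  move=> Me Me' ev ev'; apply/eqP; apply: contraLR ev => /(trivM _ _ Me Me').
  by move/disjointFl => ->.
have p_inj : {in M &, injective p}.
  move=> e e' Me Me' eq_p; have [_ pe] := pP e Me; have [_ pe'] := pP e' Me'.
  by apply: (same e e' (p e)) => //; rewrite eq_p.
have def_S : S = p @: M.
  apply/esym/eqP; rewrite eqEcard card_in_imset // leSM andbT.
  by apply/subsetP => _ /imsetP[e Me ->]; case: (pP e Me).
split=> [|e Me x y].
  rewrite def_S; apply/subsetP => _ /imsetP[e Me ->]; apply/bigcupP.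
  by exists e; rewrite //; case: (pP e Me).
have pE v : v \in S :&: e -> v = p e.
  rewrite inE {1}def_S => /andP[/imsetP[e' Me' ->] ev].
  by congr p; apply: (same e' e (p e')) => //; case: (pP e' Me').
by move=> /pE -> /pE ->.
Qed.

Lemma card_transversal M S : trivIset M -> cover M = [set: 'I_n] ->
    (forall e, e \in M -> exists2 v, v \in S & v \in e) ->
    (forall e, e \in M -> {in S :&: e &, forall x y, x = y}) ->
  #|S| = #|M|.
Proof.
move=> trivM coverM hitS oneS.
have inM v : pblock M v \in M by rewrite pblock_mem // coverM inE.
have inb v : v \in pblock M v by rewrite mem_pblock coverM inE.
rewrite -(card_in_imset (f := pblock M) (D := S)) => [|x y Sx Sy eq_b];
  last first.
  apply: (oneS (pblock M x)) => //; rewrite inE ?Sx ?Sy //=; by rewrite eq_b.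
apply: eq_card => e; apply/imsetP/idP => [[v _ ->] // | Me].
have [v Sv ev] := hitS e Me; exists v => //.
by rewrite (def_pblock trivM Me ev).
Qed.

Lemma ht_min_vertex_cover : set0 \notin E ->
  exists2 S, min_vertex_cover E S & #|S| = ht_edge_ideal E.
Proof.
move=> E0; have coverT : vertex_cover E [set: 'I_n].
  by apply/forall_inP => e Ee; rewrite setTI; apply: contraNneq E0 => <-.
rewrite /ht_edge_ideal; case: arg_minnP => // S coverS minS; exists S => //.
apply/minsetP; split=> // T coverT' sTS; apply/eqP.
by rewrite eqEcard sTS minS.
Qed.

End Combinatorics.

(** An empty edge would be the only edge, leaving every vertex isolated; without
vertices, the height would be zero and the matching number one. *)
Lemma konig_no_empty_edge n (E : {set {set 'I_n}}) :
    is_clutter E -> konig E -> (forall v, ~~ isolated E v) -> set0 \notin E.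
Proof.
move=> clutE konE noiso; apply/negP => E0.
have n_eq0 (v : 'I_n) : False.
  have /forall_inPn[e Ee] := noiso v; rewrite negbK.
  by rewrite -(clutE set0 e E0 Ee (sub0set _)) inE.
have : 1 <= matching_number E.
  apply: leq_trans
    (leq_bigmax_cond (F := fun M : {set {set 'I_n}} => #|M|) [set set0] _).
    by rewrite cards1.
  rewrite /matching sub1set E0; apply/trivIsetP => e f; rewrite !inE.
  by move=> /eqP -> /eqP ->; rewrite eqxx.
rewrite konE /ht_edge_ideal => /card_gt0P[v _]; exact: (n_eq0 v).
Qed.

(** * Nested perfect matchings *)

Section Implications.

Variables (n : nat) (E : {set {set 'I_n}}).
Implicit Types (M : {set {set 'I_n}}) (e f h S T A : {set 'I_n}).
Implicit Types (v w x y : 'I_n).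

Definition nested_matching M :=
  perfect_matching E M /\ forall e, e \in M -> nested_in E e.

Theorem unmixed_nested_matching :
    is_clutter E -> konig E -> (forall v, ~~ isolated E v) ->
    ~ has_cycle E 3 -> ~ has_cycle E 4 -> unmixed E ->
  exists2 M, nested_matching M & #|M| = ht_edge_ideal E.
Proof.
move=> clutE konE noiso no3 no4 unmE.
have E0 := konig_no_empty_edge clutE konE noiso.
have [S0 minS0 cardS0] := ht_min_vertex_cover E0.
have [M matchM cardM] : exists2 M, matching E M & #|M| = ht_edge_ideal E.
  have matching0 : matching E set0.
    by rewrite /matching sub0set; apply/trivIsetP => e; rewrite inE.
  have [M matchM maxM] :=
    arg_maxnP (fun M : {set {set 'I_n}} => #|M|) matching0.
  exists M => //; rewrite -konE; apply/eqP; rewrite eqn_leq.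
  rewrite (leq_bigmax_cond (F := fun M : {set {set 'I_n}} => #|M|)) //=.
  exact/bigmax_leqP.
have /andP[sME trivM] := matchM.
have transS S : min_vertex_cover E S ->
    S \subset cover M /\ forall e, e \in M -> {in S :&: e &, forall x y, x = y}.
  move=> minS; apply: transversal_of_card => // [|e Me].
    by rewrite cardM -cardS0 (unmE S S0).
  exact: (min_vertex_cover_hits minS (subsetP sME e Me)).
exists M => //; split=> [|e Me].
  rewrite /perfect_matching matchM -subTset; apply/subsetP => v _.
  have /forall_inPn[f Ef] := noiso v; rewrite negbK => fv.
  have [|S minS disS] := @min_vertex_cover_avoiding _ E (f :\ v).
    move=> e Ee; apply/negP => sef; have sef' : e \subset f.
      exact: subset_trans sef (subD1set _ _).
    by have := subsetP sef v;
      rewrite (clutE e f Ee Ef sef') fv !inE eqxx => /(_ isT).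
  have [w Sw fw] := min_vertex_cover_hits minS Ef.
  apply: (subsetP (transS S minS).1); have [<- // | neq_wv] := eqVneq w v.
  by have := disjointFr disS Sw; rewrite !inE neq_wv fw.
move=> f1 f2 Ef1 Ef2; have Ee := subsetP sME e Me.
apply: (nested_edges clutE no3 no4 Ee) => //.
by move=> S /transS[_]; apply.
Qed.

(** If a minimal cover [S] had two vertices [x] and [y] in a block, an edge that
meets [S] only in [x] and an edge that meets [S] only in [y] would cross in that
block. *)
Lemma nested_matching_cover M S : nested_matching M -> min_vertex_cover E S ->
  (forall e, e \in M -> exists2 v, v \in S & v \in e) /\
  (forall e, e \in M -> {in S :&: e &, forall x y, x = y}).
Proof.
case=> /andP[/andP[sME _] _] nest minS; split=> e Me.
  exact: (min_vertex_cover_hits minS (subsetP sME e Me)).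
move=> x y; rewrite !inE => /andP[Sx ex] /andP[Sy ey].
have [f1 Ef1 Sf1] := min_vertex_cover_private minS Sx.
have [f2 Ef2 Sf2] := min_vertex_cover_private minS Sy.
have f1x : x \in S :&: f1 by rewrite Sf1 inE.
have f2y : y \in S :&: f2 by rewrite Sf2 inE.
have [s12 | s21] := nest e Me f1 f2 Ef1 Ef2.
  have : x \in S :&: f2.
    by move: f1x; rewrite !inE => /andP[_ f1x]; have := subsetP s12 x;
      rewrite !inE f1x ex Sx !andbT => /(_ isT).
  by rewrite Sf2 inE => /eqP.
have : y \in S :&: f1.
  by move: f2y; rewrite !inE => /andP[_ f2y]; have := subsetP s21 y;
    rewrite !inE f2y ey Sy !andbT => /(_ isT).
by rewrite Sf1 inE => /eqP.
Qed.

Lemma nested_matching_card M S :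
  nested_matching M -> min_vertex_cover E S -> #|S| = #|M|.
Proof.
move=> nestM minS; have [hitS oneS] := nested_matching_cover nestM minS.
case: nestM => /andP[/andP[_ trivM] /eqP coverM] _.
exact: card_transversal.
Qed.

Definition block_base M v := odflt v [pick w in pblock M v].

Lemma block_baseP M v : cover M = [set: 'I_n] -> trivIset M ->
  pblock M (block_base M v) = pblock M v.
Proof.
move=> coverM trivM; rewrite /block_base; case: pickP => //= w.
by move=> bw; rewrite (same_pblock trivM bw).
Qed.

Lemma block_base_idem M v : cover M = [set: 'I_n] -> trivIset M ->
  block_base M (block_base M v) = block_base M v.
Proof.
move=> coverM trivM; rewrite {1}/block_base block_baseP //.
by rewrite /block_base; case: pickP => //= /(_ v);
  rewrite /= mem_pblock coverM inE.
Qed.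

Lemma block_base_transversal M S : nested_matching M -> min_vertex_cover E S ->
  {in S &, injective (block_base M)} /\ #|S| = #|[set v | block_base M v == v]|.
Proof.
move=> nestM minS; have [_ oneS] := nested_matching_cover nestM minS.
have [/andP[/andP[_ trivM] /eqP coverM] _] := nestM.
have inM v : pblock M v \in M by rewrite pblock_mem // coverM inE.
have inb v : v \in pblock M v by rewrite mem_pblock coverM inE.
split=> [x y Sx Sy /(congr1 (pblock M)) | ].
  rewrite !block_baseP // => eq_b; apply: (oneS (pblock M x)) => //.
    by rewrite inE Sx inb.
  by rewrite inE Sy eq_b inb.
rewrite (nested_matching_card nestM minS);
  apply/esym/card_transversal => // e Me.
  have /set0Pn[v ev] : e != set0.
    have [v _ ev] := (nested_matching_cover nestM minS).1 e Me.
    by apply/set0Pn; exists v.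
  exists (block_base M v); first by rewrite inE block_base_idem.
  have -> : e = pblock M v by rewrite (def_pblock trivM Me ev).
  by rewrite -(block_baseP v coverM trivM) inb.
move=> x y; rewrite !inE => /andP[/eqP bx ex] /andP[/eqP yb ey].
rewrite -bx -yb /block_base.
have -> : pblock M x = e by apply: def_pblock.
have -> : pblock M y = e by apply: def_pblock.
by case: pickP => //= /(_ x); rewrite /= ex.
Qed.

(** The number of edges through [v], with ties broken by the index of [v] so
that distinct vertices have distinct keys. *)
Definition vertex_key v := #|star E v| * n + v.

Lemma vertex_key_inj : injective vertex_key.
Proof.
move=> v w /(congr1 (modn^~ n)); rewrite /vertex_key !modnMDl !modn_small //.
exact: val_inj.
Qed.

Lemma vertex_key_star v w :
  vertex_key w < vertex_key v -> #|star E w| <= #|star E v|.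
Proof.
rewrite /vertex_key => lt_wv; rewrite leqNgt; apply/negP => lt_star.
have : #|star E v|.+1 * n <= #|star E w| * n by rewrite leq_mul2r lt_star orbT.
move: (ltn_ord v).
by rewrite mulSn; lia.
Qed.

(** All edges through [w] pass through [v] too, so [v |: S :\ w] is a cover; it
has as many vertices as each minimal cover contained in it. *)
Lemma vertex_exchange M S e v w : nested_matching M -> min_vertex_cover E S ->
    e \in M -> v \in e -> w \in e -> w \in S -> v \notin S ->
    vertex_key w < vertex_key v -> min_vertex_cover E (v |: S :\ w).
Proof.
move=> nestM minS Me ev ew Sw Sv lt_wv.
have sstar := nested_star (nestM.2 e Me) ev ew (vertex_key_star lt_wv).
have coverS' : vertex_cover E (v |: S :\ w).
  have /minsetP[/forall_inP coverS _] := minS.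
  apply/forall_inP => f Ef; apply/set0Pn.
  have [fw | fw] := boolP (w \in f).
    exists v; rewrite !inE eqxx /=.
    by have := subsetP sstar f; rewrite !inE Ef fw => /(_ isT).
  have /set0Pn[x /setIP[Sx fx]] := coverS f Ef; exists x.
  by rewrite !inE Sx fx andbT andbT; apply/orP; right;
    apply: contraNneq fw => <-.
have [T minT sT] := min_vertex_cover_sub coverS'.
suff <- : T = v |: S :\ w by [].
apply/eqP; rewrite eqEcard sT (nested_matching_card nestM minT).
rewrite cardsU1 !inE (negPf Sv) andbF -(nested_matching_card nestM minS).
by rewrite (cardsD1 w S) Sw /=.
Qed.

Definition cover_weight S := \sum_(v in S) vertex_key v.

(** Otherwise the bijection [tau] from [S] to [T] along the blocks would never
lower the key of a vertex; as the total weight does not increase, it would then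
preserve the keys, hence be the identity. *)
Lemma heavier_cover_vertex M S T : nested_matching M ->
    min_vertex_cover E S -> min_vertex_cover E T -> S != T ->
    cover_weight T <= cover_weight S ->
  exists e v w, [/\ e \in M, v \in S :&: e, w \in T :&: e &
    vertex_key w < vertex_key v].
Proof.
move=> nestM minS minT neq_ST le_TS; apply: contrapT => no_heavier.
have [hitS oneS] := nested_matching_cover nestM minS.
have [hitT oneT] := nested_matching_cover nestM minT.
have [/andP[/andP[_ trivM] /eqP coverM] _] := nestM.
have inM v : pblock M v \in M by rewrite pblock_mem // coverM inE.
have inb v : v \in pblock M v by rewrite mem_pblock coverM inE.
(* The default values are never used, as [T] meets every block. *)
pose tau v := odflt v [pick w in T :&: pblock M v].
have tauP v : tau v \in T :&: pblock M v.
  rewrite /tau; case: pickP => //= no_w; have [w Tw bw] := hitT _ (inM v).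
  by have := no_w w; rewrite inE Tw bw.
have b_tau v : pblock M (tau v) = pblock M v.
  by have /setIP[_ bt] := tauP v; rewrite (same_pblock trivM bt).
have tau_inj : {in S &, injective tau}.
  move=> x y Sx Sy /(congr1 (pblock M)); rewrite !b_tau => eq_b.
  apply: (oneS (pblock M x)) => //; first by rewrite inE Sx inb.
  by rewrite inE Sy eq_b inb.
have sub_tau : tau @: S = T.
  apply/eqP; rewrite eqEcard card_in_imset // (nested_matching_card nestM minS).
  rewrite (nested_matching_card nestM minT) leqnn andbT.
  by apply/subsetP => _ /imsetP[v _ ->]; have /setIP[] := tauP v.
have le_tau v : v \in S -> vertex_key v <= vertex_key (tau v).
  move=> Sv; rewrite leqNgt; apply/negP => lt_tau; apply: no_heavier.
  by exists (pblock M v), v, (tau v); split; rewrite // inE Sv inb.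
have weightT : cover_weight T = \sum_(v in S) vertex_key (tau v).
  by rewrite /cover_weight -sub_tau big_imset.
have eq_tau v : v \in S -> tau v = v.
  move=> Sv; apply: vertex_key_inj; apply/eqP; rewrite eqn_leq le_tau // andbT.
  rewrite leqNgt; apply/negP => lt_v; move: le_TS; apply/negP;
    rewrite -ltnNge weightT /cover_weight.
  rewrite (bigD1 v) // [X in _ < X](bigD1 v) //= -addSn leq_add //.
  by apply: leq_sum => w /andP[Sw _]; apply: le_tau.
case/eqP: neq_ST; rewrite -sub_tau -[LHS]imset_id.
by apply: eq_in_imset => v Sv; rewrite eq_tau.
Qed.

(** The facets are the complements of the minimal covers, listed by decreasing
weight.  The facet required before the complement of [T] is the complement of
[v |: T :\ w], where [v] and [w] come from [heavier_cover_vertex]. *)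
Theorem nested_matching_shellable M :
  nested_matching M -> shellable (indep_complex E).
Proof.
move=> nestM; pose heavier S T := cover_weight T <= cover_weight S.
pose Cs := sort heavier (enum [set S | min_vertex_cover E S]).
have CsE S : (S \in Cs) = min_vertex_cover E S by rewrite mem_sort mem_enum inE.
have uniqCs : uniq Cs by rewrite sort_uniq enum_uniq.
have heavier_trans : transitive heavier.
  by move=> T S U /= le_TS le_UT; apply: leq_trans le_UT le_TS.
have sortCs : sorted heavier Cs.
  by apply: sort_sorted => S T; apply: leq_total.
have nthC k : k < size Cs -> nth set0 (map (@setC _) Cs) k = ~: nth set0 Cs k.
  by move=> lt_k; rewrite (nth_map set0).
exists (map (@setC _) Cs); split.
- by rewrite map_inj_uniq //; apply: setC_inj.
- move=> F; rewrite facets_indep_complex -CsE -[F in LHS]setCK mem_map //.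
  exact: setC_inj.
rewrite size_map => i j /andP[lt_ij lt_j]; have lt_i := ltn_trans lt_ij lt_j.
have minC k : k < size Cs -> min_vertex_cover E (nth set0 Cs k).
  by move=> lt_k; rewrite -CsE mem_nth.
set S := nth set0 Cs i; set T := nth set0 Cs j.
have neq_ST : S != T by rewrite nth_uniq // neq_ltn lt_ij.
have le_TS : cover_weight T <= cover_weight S.
  exact: (sorted_ltn_nth heavier_trans set0 sortCs).
have [e [v [w [Me /setIP[Sv ev] /setIP[Tw ew] lt_wv]]]] :=
  heavier_cover_vertex nestM (minC i lt_i) (minC j lt_j) neq_ST le_TS.
have Tv : v \notin T.
  apply/negP => Tv; have [_ /(_ e Me)] :=
    nested_matching_cover nestM (minC j lt_j).
  move/(_ v w); rewrite !inE -/T Tv Tw ev ew => /(_ isT isT) eq_vw.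
  by rewrite eq_vw ltnn in lt_wv.
have minU := vertex_exchange nestM (minC j lt_j) Me ev ew Tw Tv lt_wv.
set U := v |: _ in minU; have CsU : U \in Cs by rewrite CsE.
have lt_l : index U Cs < size Cs by rewrite index_mem.
have weightU : cover_weight T < cover_weight U.
  rewrite /cover_weight /U big_setU1 ?inE ?(negPf Tv) ?andbF //=.
  by rewrite (big_setD1 w) //= ltn_add2r.
exists v, (index U Cs); rewrite !nthC // nth_index //; split.
- by rewrite !inE -/S -/T negbK Sv Tv.
- rewrite ltnNge; apply/negP => le_jl; move: weightU; apply/negP;
    rewrite -leqNgt.
  have := sorted_leq_nth heavier_trans (fun S => leqnn _) set0 sortCs.
  by move/(_ j (index U Cs) lt_j lt_l le_jl); rewrite nth_index.
- apply/setP => x; rewrite !inE -/T negbK.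
  have [-> | neq_xv] := eqVneq x v; first by rewrite Tv.
  by case: (x \in T); rewrite ?andbF ?andbT.
Qed.

Lemma pure_unmixed : pure_complex (indep_complex E) <-> unmixed E.
Proof.
have cardC S : #|~: S| = n - #|S| by rewrite cardsCs setCK card_ord.
have le_n S : #|S| <= n by rewrite -[X in _ <= X]card_ord max_card.
split=> [pureE S T minS minT | unmE S T].
  have := pureE (~: S) (~: T);
    rewrite !facets_indep_complex !setCK => /(_ minS minT).
  by rewrite !cardC; move: (le_n S) (le_n T); lia.
rewrite !facets_indep_complex => minS minT; have := unmE _ _ minS minT.
by rewrite !cardC; move: (le_n S) (le_n T); lia.
Qed.

End Implications.

(** * The equivalence *)

Theorem corollary2p19 (K : fieldType) (n : nat) (E : {set {set 'I_n}})
  (clutterE : is_clutter E)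
  (konigE : konig E)
  (no_isolated : forall v : 'I_n, ~~ isolated E v)
  (no_cycle3 : ~ has_cycle E 3)
  (no_cycle4 : ~ has_cycle E 4) :
  [<-> (* (a) *) unmixed E;
       (* (b) *) exists M : {set {set 'I_n}},
         [/\ perfect_matching E M,
             #|M| = ht_edge_ideal E,
             forall e, e \in M -> exists2 v, v \in e & free_vertex E v &
             forall f1 f2 e, f1 \in E -> f2 \in E -> e \in M ->
               (f1 :&: e \subset f2 :&: e) \/ (f2 :&: e \subset f1 :&: e)];
       (* (c) *) cohen_macaulay_quotient (edge_ideal_gens K E);
       (* (d) *) pure_complex (indep_complex E) /\
                 shellable (indep_complex E)].
Proof.
have a_to_b : unmixed E ->
  exists2 M, nested_matching E M & #|M| = ht_edge_ideal E.
  exact: unmixed_nested_matching.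
tfae.
- case/a_to_b => M nestM cardM; exists M.
  have [/andP[/andP[sME trivM] coverM] nest] := nestM.
  split=> // [|e Me|f1 f2 e Ef1 Ef2 Me].
  + by rewrite /perfect_matching /matching sME trivM.
  + apply: nested_free_vertex => //; [exact: nest | exact: (subsetP sME) |].
    have := konig_no_empty_edge clutterE konigE no_isolated.
    by apply: contraNneq => <-; apply: (subsetP sME).
  + exact: nest.
- case=> M [perfM cardM _ nest].
  have nestM : nested_matching E M by split=> // e Me f1 f2 Ef1 Ef2;
    apply: nest.
  have /andP[/andP[_ trivM] /eqP coverM] := perfM.
  apply: (@shellable_cohen_macaulay K n E (block_base M)).
  + by move=> v; apply: block_base_idem.
  + by move=> S; apply: block_base_transversal.
  + exact: nested_matching_shellable nestM.
- move=> CM; have unmE := cohen_macaulay_unmixed CM; split;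
    first exact/pure_unmixed.
  by have [M nestM _] := a_to_b unmE; apply: nested_matching_shellable nestM.
- by case=> /pure_unmixed.
Qed.
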